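(* There is a polynomial-time algorithm that, given an instance $(G,k,C,N)$ of the GL-Partition problem together with a CDS partition of $G$ of size $k$, computes a GL-partition of the instance, i.e. a partition of $V(G)$ into $k$ disjoint subsets $V_1,\ldots,V_k$ such that for all $i\in[k]$: $|V_i|=n_i$, $c_i\in V_i$, and the induced subgraph $G[V_i]$ is connected.
   Context: All graphs are finite, undirected and simple. GL-Partition problem: an instance $(G,k,C,N)$ consists of a graph $G=(V,E)$, an integer $k\ge 1$, a set of $k$ distinct vertices $C=\{c_1,\ldots,c_k\}\subseteq V$ (terminals), and $k$ positive integers $N=\{n_1,\ldots,n_k\}$ (a list indexed by $[k]$, repetitions allowed) with $\sum_{i=1}^k n_i=|V|$. The task is to compute a GL-partition: a partition of $V$ into disjoint sets $V_1,\ldots,V_k$ with $|V_i|=n_i$, $c_i\in V_i$ and $G[V_i]$ connected for all $i\in[k]$. A connected dominating set (CDS) of $G$ is a nonempty set $S\subseteq V(G)$ such that $G[S]$ is connected and every vertex of $V(G)\setminus S$ is adjacent to some vertex of $S$. A CDS partition of $G$ of size $k$ is a partition of $V(G)$ into $k$ pairwise disjoint sets, each of which is a connected dominating set of $G$. *)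

(* Defs.v *)
From mathcomp Require Import all_boot.

Set Implicit Arguments.
Unset Strict Implicit.
Unset Printing Implicit Defensive.

Record graph := Graph {
  vertex :> finType;
  adj : rel vertex;
  adj_sym : symmetric adj;
  adj_irr : irreflexive adj }.

(* The induced subgraph G[S]; vertices outside S become isolated. *)
Definition induced (G : graph) (S : {set G}) : rel G :=
  [rel x y | [&& x \in S, y \in S & adj x y]].

(* Holds of the empty set; nonemptiness is required separately in [cds] and
   follows from c_i \in V_i in [gl_partition]. *)
Definition induced_connected (G : graph) (S : {set G}) : Prop :=
  {in S &, forall x y, connect (induced S) x y}.

Definition cds (G : graph) (S : {set G}) : Prop :=
  [/\ S != set0,
      induced_connected S
    & forall v, v \notin S -> exists2 u, u \in S & adj v u].

Definition indexed_partition (T : finType) (k : nat)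
    (V : 'I_k -> {set T}) : Prop :=
  (forall i j, i != j -> [disjoint V i & V j]) /\
  \bigcup_(i < k) V i = [set: T].

Definition cds_partition (G : graph) (k : nat) (D : 'I_k -> {set G}) : Prop :=
  indexed_partition D /\ forall i, cds (D i).

Record gl_instance := GLInstance {
  gl_graph : graph;
  gl_k : nat;
  gl_k_gt0 : 0 < gl_k;
  gl_term : 'I_gl_k -> gl_graph;
  gl_term_inj : injective gl_term;
  gl_size : 'I_gl_k -> nat;
  gl_size_gt0 : forall i, 0 < gl_size i;
  gl_size_sum : \sum_(i < gl_k) gl_size i = #|gl_graph| }.

Definition gl_partition (I : gl_instance)
    (V : 'I_(gl_k I) -> {set gl_graph I}) : Prop :=
  indexed_partition V /\
  forall i, [/\ #|V i| = gl_size i, gl_term i \in V i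
              & induced_connected (V i)].

(* Unit-cost RAM with addition and truncated subtraction but no
   multiplication: t steps lengthen the numbers in use by at most O(t) bits,
   so polynomial time on this machine is polynomial time on a Turing machine,
   and conversely. *)

Inductive instr :=
  | IConst of nat & nat
  | IAdd of nat & nat & nat
  | ISub of nat & nat & nat
  | ILoad of nat & nat
  | IStore of nat & nat
  | IJump of nat
  | IJumpZ of nat & nat.

Definition program := seq instr.

Record config := Config { pc : nat; reg : nat -> nat; mem : nat -> nat }.

Definition upd (f : nat -> nat) (a v : nat) : nat -> nat :=
  fun b => if b == a then v else f b.

Definition exec (i : instr) (cf : config) : config :=
  let: Config p R M := cf in
  match i with
  | IConst r c => Config p.+1 (upd R r c) M
  | IAdd r s u => Config p.+1 (upd R r (R s + R u)) M
  | ISub r s u => Config p.+1 (upd R r (R s - R u)) M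
  | ILoad r s => Config p.+1 (upd R r (M (R s))) M
  | IStore r s => Config p.+1 R (upd M (R r) (R s))
  | IJump l => Config l R M
  | IJumpZ r l => Config (if R r == 0 then l else p.+1) R M
  end.

(* The machine halts, and its configuration no longer changes, once the
   program counter leaves the program. *)
Definition halted (P : program) (cf : config) : bool := size P <= pc cf.

Definition step (P : program) (cf : config) : config :=
  if halted P cf then cf else exec (nth (IJump 0) P (pc cf)) cf.

(* A word w is presented, both on input and on output, as R_0 = size w and
   M[0], ..., M[size w - 1] = w; initially all else is 0. *)
Definition init (w : seq nat) : config :=
  Config 0 (upd (fun=> 0) 0 (size w)) (nth 0 w).

Definition output (cf : config) : seq nat := mkseq (mem cf) (reg cf 0).

Definition computes_within (P : program) (w w' : seq nat) (t : nat) : Prop :=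
  let cf := iter t (step P) (init w) in halted P cf /\ output cf = w'.

(* Vertices are numbered by [enum_rank]; a family of k vertex sets is written
   as its k x |V| incidence matrix, row by row. No entry of an encoded
   instance exceeds |V|, which is less than the length of the word, so being
   polynomial in the number of entries is the same as being polynomial in the
   number of bits. *)

Definition encode_family (T : finType) (k : nat)
    (V : 'I_k -> {set T}) : seq nat :=
  [seq nat_of_bool (x \in V i) | i <- enum 'I_k, x <- enum T].

Definition encode_graph (G : graph) : seq nat :=
  [seq nat_of_bool (adj x y) | x <- enum G, y <- enum G].

Definition encode_input (I : gl_instance)
    (D : 'I_(gl_k I) -> {set gl_graph I}) : seq nat :=
  [:: #|gl_graph I|; gl_k I]
    ++ encode_graph (gl_graph I)
    ++ [seq nat_of_ord (enum_rank (gl_term i)) | i <- enum 'I_(gl_k I)]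
    ++ [seq gl_size i | i <- enum 'I_(gl_k I)]
    ++ encode_family D.

(* Main.v *)
Require Import Defs.
From mathcomp Require Import all_boot.
From mathcomp Require Import zify.

(* Each terminal is matched with a part of the CDS partition, its own part
   whenever that part has not been matched yet. A group consists of the terminals
   lying in a common part, the base, together with the parts matched to them, so
   that it has as many parts as terminals. By averaging some group has at least
   as many vertices as its targets require. We serve it exactly and move its
   unused vertices into the base of another group, where they do no harm since a
   superset of a CDS is a CDS.

   Inside a group, split the base into connected pieces, one per terminal,
   and let every other vertex be held by a terminal to whose piece it is
   adjacent. While some terminal s holds too few vertices, it picks a part
   that no other terminal has picked, grows a connected subset of it attached
   to its piece, and takes over the vertices of this subset from whoever held
   them; it never picks a second part. The vertices taken over hang
   individually on a base piece, so no class gets disconnected. A terminal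
   that has picked a part never exceeds its target, so s cannot be left
   without a part: otherwise all the other parts of the group would be picked
   by distinct terminals and the group would be too small. Since a vertex
   pulled in this way stays where it is, the process stops after at most |V|
   steps, and then each terminal has enough vertices or holds a whole
   dominating part. First the former terminals shrink to their targets, then
   the latter absorb released vertices, to which they are all adjacent. *)

Set Implicit Arguments.
Unset Strict Implicit.
Unset Printing Implicit Defensive.

(** * A loop language and its compilation to the machine *)

(** The obstacle is that one part may contain several terminals and another none, so a terminal
    needs a foothold in the base before it can enter a part of its own. Preferring a terminal's own
    part in the matching ensures that each base belongs to the very group whose terminals live in
    it. Shrinking a class to its target is done from inside: the answer regrows from the terminal
    within the class it holds, so no removable non-cut vertices have to be found. For the time
    bound, the algorithm is written in a loop language in which every loop makes exactly n = |V|
    turns. Its running time is then polynomial by syntax, the nesting depth of the loops being the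
    exponent. A process that must go on until no move applies becomes n sweeps over all pairs: each
    move raises, for good, a measure that never exceeds n, so n sweeps exhaust it. *)

Inductive exp :=
  | EC of nat
  | EV of nat
  | EA of nat & exp
  | EM of exp
  | EAdd of exp & exp
  | ESub of exp & exp
  | EEq of exp & exp
  | ELt of exp & exp
  | EAnd of exp & exp
  | ENot of exp.

Inductive com :=
  | Skip
  | SetV of nat & exp
  | SetA of nat & exp & exp
  | SetM of exp & exp
  | Seq of com & com
  | If of exp & com & com
  | For of nat & com.

Record store :=
  Store { va : nat -> nat; ar : nat -> nat -> nat; lo : nat -> nat }.

Definition upd2 (f : nat -> nat -> nat) (t a v : nat) : nat -> nat -> nat :=
  fun u b => if (u == t) && (b == a) then v else f u b.

Definition setv s x v := Store (upd (va s) x v) (ar s) (lo s).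
Definition seta s t i v := Store (va s) (upd2 (ar s) t i v) (lo s).
Definition setl s i v := Store (va s) (ar s) (upd (lo s) i v).

Section Semantics.

(* [n] is the number of turns of every loop, [L] the length of the input. *)
Variables n L : nat.

(** [EM] may read any address, so its meaning beyond the input has to be fixed as well. With this
    choice the machine memory and the store agree at every address. *)
Definition flat (s : store) (a : nat) : nat :=
  if a < L then lo s a else ar s ((a - L) %% 16) ((a - L) %/ 16).

Fixpoint ev (e : exp) (s : store) : nat :=
  match e with
  | EC c => c
  | EV x => va s x
  | EA t e => ar s t (ev e s)
  | EM e => flat s (ev e s)
  | EAdd e f => ev e s + ev f s
  | ESub e f => ev e s - ev f s
  | EEq e f => ev e s == ev f s
  | ELt e f => ev e s < ev f s
  | EAnd e f => (ev e s != 0) && (ev f s != 0)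
  | ENot e => ev e s == 0
  end.

(** The turn number lives outside the store and is copied into [x] at each turn, so a body that
    overwrites [x] cannot change the number of turns. A [SetM] past the input is dropped, as it
    would damage an array. *)
Fixpoint run (c : com) (s : store) : store :=
  match c with
  | Skip => s
  | SetV x e => setv s x (ev e s)
  | SetA t e f => seta s t (ev e s) (ev f s)
  | SetM e f => if ev e s < L then setl s (ev e s) (ev f s) else s
  | Seq c d => run d (run c s)
  | If e c d => if ev e s != 0 then run c s else run d s
  | For x c => iteri n (fun i s => run c (setv s x i)) s
  end.

End Semantics.

(** * Well-formed programs and their compilation *)

Fixpoint wfe (e : exp) : bool :=
  match e with
  | EC _ => true
  | EV x => x < 16
  | EA t e => (t < 16) && wfe e
  | EM e | ENot e => wfe e
  | EAdd e f | ESub e f | EEq e f | ELt e f | EAnd e f => wfe e && wfe f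
  end.

Fixpoint wfc (c : com) : bool :=
  match c with
  | Skip => true
  | SetV x e => (x < 16) && wfe e
  | SetA t e f => [&& t < 16, wfe e & wfe f]
  | SetM e f => wfe e && wfe f
  | Seq c d => wfc c && wfc d
  | If e c d => [&& wfe e, wfc c & wfc d]
  | For x c => (x < 16) && wfc c
  end.

(* Register 0 holds L, register 1 holds n, register x + 2 the variable x < 16;
   the registers from 18 on are temporaries and loop counters. Cell i of the
   array t < 16 sits at address L + 16 i + t, so that no address computation
   needs a multiplication. *)

Definition caddr (t r : nat) : program :=
  [:: IAdd r r r; IAdd r r r; IAdd r r r; IAdd r r r; IAdd r r 0;
      IConst r.+1 t; IAdd r r r.+1].

Lemma size_caddr t r : size (caddr t r) = 7.
Proof. by []. Qed.

(** The value ends up in register [r]; only registers from [r] on are written. Tests are computed by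
    truncated subtraction, for instance a = b as 1 - ((a - b) + (b - a)), so expressions need no
    jumps. *)
Fixpoint cexp (e : exp) (r : nat) : program :=
  match e with
  | EC c => [:: IConst r c]
  | EV x => [:: IConst r 0; IAdd r r x.+2]
  | EA t e => (cexp e r ++ caddr t r) ++ [:: ILoad r r]
  | EM e => cexp e r ++ [:: ILoad r r]
  | EAdd e f => cexp e r ++ cexp f r.+1 ++ [:: IAdd r r r.+1]
  | ESub e f => cexp e r ++ cexp f r.+1 ++ [:: ISub r r r.+1]
  | EEq e f => cexp e r ++ cexp f r.+1 ++
      [:: ISub r.+2 r r.+1; ISub r.+1 r.+1 r; IAdd r.+2 r.+2 r.+1;
          IConst r 1; ISub r r r.+2]
  | ELt e f => cexp e r ++ cexp f r.+1 ++
      [:: ISub r.+2 r.+1 r; IConst r.+1 1; ISub r r.+1 r.+2; ISub r r.+1 r]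
  | EAnd e f => cexp e r ++ cexp f r.+1 ++
      [:: IConst r.+2 1; ISub r r.+2 r; ISub r.+1 r.+2 r.+1;
          IAdd r r r.+1; ISub r r.+2 r]
  | ENot e => cexp e r ++ [:: IConst r.+1 1; ISub r r.+1 r]
  end.

(** Jumps are absolute, hence the position [p] of the first instruction. A loop counts in [r], uses
    [r.+1] as scratch, and compiles its body from [r.+2] on. *)
Fixpoint ccom (c : com) (p r : nat) : program :=
  match c with
  | Skip => [::]
  | SetV x e => cexp e r ++ [:: IConst r.+1 0; IAdd x.+2 r r.+1]
  | SetA t e f => ((cexp f r ++ cexp e r.+1) ++ caddr t r.+1) ++ [:: IStore r.+1 r]
  | SetM e f =>
      let q := cexp f r ++ cexp e r.+1 in
      q ++ [:: ISub r.+2 0 r.+1; IJumpZ r.+2 (p + size q + 3); IStore r.+1 r]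
  | Seq c d => let q := ccom c p r in q ++ ccom d (p + size q) r
  | If e c d =>
      let q := cexp e r in
      let p1 := p + size q + 1 in
      let q1 := ccom c p1 r in
      let p2 := p1 + size q1 + 1 in
      let q2 := ccom d p2 r in
      q ++ IJumpZ r p2 :: q1 ++ IJump (p2 + size q2) :: q2
  | For x c =>
      let q := ccom c (p + 5) r.+2 in
      [:: IConst r 0; ISub r.+1 1 r; IJumpZ r.+1 (p + 5 + size q + 3);
          IConst r.+1 0; IAdd x.+2 r r.+1]
        ++ q ++ [:: IConst r.+1 1; IAdd r r r.+1; IJump (p + 1)]
  end.

Definition code_at (P : program) (p : nat) (c : program) : Prop :=
  exists pre post, P = pre ++ c ++ post /\ size pre = p.

Lemma code_at_cat P p c d :
  code_at P p (c ++ d) -> code_at P p c /\ code_at P (p + size c) d.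
Proof.
move=> [pre [post [-> <-]]]; split.
  by exists pre, (d ++ post); rewrite -catA.
by exists (pre ++ c), post; rewrite size_cat -!catA.
Qed.

Lemma code_at_cons P p i c :
  code_at P p (i :: c) ->
  (forall R M, step P (Config p R M) = exec i (Config p R M)) /\
  code_at P p.+1 c.
Proof.
move=> h; split; last by have [_] := @code_at_cat P p [:: i] c h; rewrite addn1.
move: h => [pre [post [-> <-]]] R M.
rewrite /step /halted /= size_cat /= leqNgt -[X in X < _]addn0 ltn_add2l /=.
by rewrite nth_cat ltnn subnn.
Qed.

Definition straight (i : instr) : bool :=
  if i is (IJump _ | IJumpZ _ _) then false else true.

Definition xs (c : program) (cf : config) : config :=
  foldl (fun cf i => exec i cf) cf c.

Lemma xs_cat c d cf : xs (c ++ d) cf = xs d (xs c cf).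
Proof. by rewrite /xs foldl_cat. Qed.

(** Straight code only advances the program counter, so it can be evaluated as a plain fold over its
    instructions. *)
Lemma straightP P c p R M :
  all straight c -> code_at P p c ->
  iter (size c) (step P) (Config p R M) = xs c (Config p R M).
Proof.
elim: c p R M => [//|i c IH] p R M /= /andP[si sc] /code_at_cons[hs hc].
rewrite -iterS iterSr hs; case: i si hs => //= *; exact: IH.
Qed.

(** * Simulation of the loop language by the compiled code *)

Section Simulation.

Variables n L : nat.

Definition simR (s : store) (R : nat -> nat) : Prop :=
  [/\ R 0 = L, R 1 = n & forall x, x < 16 -> R x.+2 = va s x].

Definition simM (s : store) (M : nat -> nat) : Prop :=
  forall a, M a = flat L s a.

Lemma simR_low s R R' :
  simR s R -> (forall q, q < 18 -> R' q = R q) -> simR s R'.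
Proof.
move=> [h0 h1 h2] h; split; rewrite ?h // => x lx; rewrite h ?h2 //; lia.
Qed.

Lemma flat_arr s t i : t < 16 -> flat L s (L + 16 * i + t) = ar s t i.
Proof.
move=> lt; rewrite /flat -addnA ltnNge leq_addr /= addKn.
by rewrite mulnC modnMDl divnMDl // modn_small // divn_small // addn0.
Qed.

Lemma straight_cexp e r : all straight (cexp e r).
Proof.
elim: e r => //=.
- by move=> t e IH r; rewrite !all_cat IH.
- by move=> e IH r; rewrite all_cat IH.
all: try by move=> e IHe f IHf r; rewrite !all_cat IHe IHf.
by move=> e IH r; rewrite all_cat IH.
Qed.

Lemma updE f a v b : upd f a v b = if b == a then v else f b.
Proof. by []. Qed.

Lemma caddrP t r p R M : R 0 = L -> 18 <= r ->
  exists2 R', xs (caddr t r) (Config p R M) = Config (p + 7) R' M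
    & R' r = L + 16 * R r + t /\ forall q, q < r -> R' q = R q.
Proof.
move=> h0 hr; rewrite /xs /=; eexists; first by congr Config; lia.
split; last by move=> q hq; rewrite !updE; do ?case: eqP => ?; lia.
rewrite !updE !eqxx; do ?case: eqP => ?; lia.
Qed.

Lemma cexpP e r p R M s :
  wfe e -> 18 <= r -> simR s R -> simM s M ->
  exists2 R', xs (cexp e r) (Config p R M)
                = Config (p + size (cexp e r)) R' M
    & R' r = ev L e s /\ forall q, q < r -> R' q = R q.
Proof.
elim: e r p R => /=.
- move=> c r p R _ hr sR sM; eexists; first by rewrite /xs /= addn1.
  by rewrite updE eqxx; split=> // q hq; rewrite updE; case: eqP => //; lia.
- move=> x r p R hx hr [_ _ sR] sM; eexists; first by rewrite /xs /= addn2.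
  rewrite -sR // !updE !eqxx; case: eqP => [|_]; first lia.
  split=> // q hq; rewrite !updE; do ?case: eqP => ?; lia.
- move=> t e IH r p R /andP[ht we] hr sR sM.
  have [R1 E1 [v1 l1]] := IH r p R we hr sR sM.
  have [|R2 E2 [v2 l2]] := @caddrP t r (p + size (cexp e r)) R1 M _ hr.
    by rewrite l1; [case: sR | lia].
  eexists.
    rewrite !xs_cat E1 E2 /xs /= !size_cat size_caddr /=; congr Config; lia.
  rewrite updE eqxx v2 v1 sM flat_arr //; split=> // q hq.
  by rewrite updE; case: eqP => [|_]; [lia | rewrite l2 ?l1].
- move=> e IH r p R we hr sR sM.
  have [R1 E1 [v1 l1]] := IH r p R we hr sR sM.
  eexists; first by rewrite !xs_cat E1 /xs /= size_cat /=; congr Config; lia.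
  rewrite updE eqxx v1 sM; split=> // q hq.
  by rewrite updE; case: eqP => [|_]; [lia | rewrite l1].
1-5: move=> e IHe f IHf r p R /andP[we wf] hr sR sM;
  have [R1 E1 [v1 l1]] := IHe r p R we hr sR sM;
  have [||R2 E2 [v2 l2]] := IHf r.+1 (p + size (cexp e r)) R1 wf _ _ sM;
    [ lia | by apply: (simR_low sR) => q hq; apply: l1; lia | ];
  have v3 : R2 r = ev L e s by rewrite l2 ?v1.
1-5: eexists; first by
  rewrite !xs_cat E1 E2 /xs /= !size_cat /=; congr Config; lia.
1-5: rewrite !updE !eqxx; split; last
  by move=> q hq; rewrite !updE; have := l1 q hq; have := l2 q (leqW hq);
     do ?case: eqP => ?; lia.
1-5: by do ?case: eqP => ?; rewrite ?v3 ?v2; lia.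
- move=> e IH r p R we hr sR sM.
  have [R1 E1 [v1 l1]] := IH r p R we hr sR sM.
  eexists; first by rewrite !xs_cat E1 /xs /= size_cat /=; congr Config; lia.
  rewrite !updE !eqxx; split; last
    by move=> q hq; rewrite !updE; have := l1 q hq; do ?case: eqP => ?; lia.
  by do ?case: eqP => ?; rewrite ?v1; lia.
Qed.

(** The size of an atomic command does not depend on its position, hence the 0. In a loop, 7 counts
    the four instructions before the body and the three after it, and 3 counts the initialisation
    and the two instructions of the final test. *)
Fixpoint cost (c : com) (r : nat) : nat :=
  match c with
  | Seq c d => cost c r + cost d r
  | If e c d => size (cexp e r) + (cost c r + cost d r + 2)
  | For x c => n * (cost c r.+2 + 7) + 3
  | _ => size (ccom c 0 r)
  end.

Lemma flat_seta s t i v a : t < 16 ->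
  flat L (seta s t i v) a = if a == L + 16 * i + t then v else flat L s a.
Proof.
move=> lt; rewrite /flat /= /upd2; case: ltnP => ha.
  by case: eqP => //; lia.
have -> : (a == L + 16 * i + t) = ((a - L) %% 16 == t) && ((a - L) %/ 16 == i).
  by lia.
by [].
Qed.

Lemma flat_setl s i v a : i < L ->
  flat L (setl s i v) a = if a == i then v else flat L s a.
Proof. by move=> hi; rewrite /flat /= /upd; case: eqP => // ->; rewrite hi. Qed.

Lemma iter_trans T (f : T -> T) a b x y z :
  iter a f x = y -> iter b f y = z -> iter (a + b) f x = z.
Proof. by move=> <- <-; rewrite addnC iterD. Qed.

(** The last clause protects the counters of the enclosing loops, which lie in the registers between
    18 and [r]; the induction needs it at [For]. *)
Lemma ccomP c r p R M s P :
  wfc c -> 18 <= r -> code_at P p (ccom c p r) -> simR s R -> simM s M ->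
  exists t R' M', [/\ t <= cost c r,
    iter t (step P) (Config p R M) = Config (p + size (ccom c p r)) R' M',
    simR (run n L c s) R', simM (run n L c s) M'
    & forall q, 18 <= q < r -> R' q = R q].
Proof.
elim: c r p R M s => /=.
- move=> r p R M s _ _ _ sR sM; exists 0, R, M; split=> //.
  by rewrite addn0.
- move=> x e r p R M s /andP[wx we] hr hc sR sM.
  have [R1 E1 [v1 l1]] := cexpP p we hr sR sM.
  have st : all straight (cexp e r ++ [:: IConst r.+1 0; IAdd x.+2 r r.+1]).
    by rewrite all_cat straight_cexp.
  eexists _, _, _; split; first exact: leqnn.
  + rewrite (straightP _ _ st hc) xs_cat E1 /xs /= size_cat /=; congr Config;
    lia.
  + have [h0 h1 h2] := sR; split; rewrite !updE.
    * by rewrite /= l1 ?h0 //; lia.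
    * by rewrite /= eqSS; case: eqP => [?|_]; [lia | rewrite l1 ?h1 //; lia].
    * move=> y hy; rewrite /= !updE !eqSS; case: (y =P x) => [_|ne].
        by rewrite eqxx v1; case: eqP => ?; lia.
      by case: eqP => [?|_]; [lia | rewrite l1 ?h2 //; lia].
  + exact: sM.
  + by move=> q hq; rewrite !updE -l1; do ?case: eqP => ?; lia.
- move=> t e f r p R M s /and3P[wt we wf] hr hc sR sM.
  have [R1 E1 [v1 l1]] := cexpP p wf hr sR sM.
  have [||R2 E2 [v2 l2]] := @cexpP e r.+1 (p + size (cexp f r)) R1 M s we _ _ sM;
    [ lia | by apply: (simR_low sR) => q hq; apply: l1; lia | ].
  have [||R3 E3 [v3 l3]] :=
    @caddrP t r.+1 (p + size (cexp f r) + size (cexp e r.+1)) R2 M _ _;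
    [ by rewrite l2 ?l1; [case: sR | lia..] | lia | ].
  have st : all straight
    (((cexp f r ++ cexp e r.+1) ++ caddr t r.+1) ++ [:: IStore r.+1 r]).
    by rewrite !all_cat !straight_cexp.
  have l q : q < r -> R3 q = R q by move=> hq; rewrite l3 ?l2 ?l1 //; lia.
  eexists _, _, _; split; first exact: leqnn.
  + rewrite (straightP _ _ st hc) !xs_cat E1 E2 E3 /xs /= !size_cat size_caddr /=.
    congr Config; lia.
  + by apply: (simR_low sR) => q hq; apply: l; lia.
  + move=> a; rewrite flat_seta // updE v3 v2 l3 // l2 // v1.
    by case: eqP.
  + by move=> q hq; apply: l; lia.
- move=> e f r p R M s /andP[we wf] hr hc sR sM.
  have [R1 E1 [v1 l1]] := cexpP p wf hr sR sM.
  have [||R2 E2 [v2 l2]] := @cexpP e r.+1 (p + size (cexp f r)) R1 M s we _ _ sM;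
    [ lia | by apply: (simR_low sR) => q hq; apply: l1; lia | ].
  move: hc; set q0 := cexp f r ++ cexp e r.+1 => hc.
  have st : all straight (q0 ++ [:: ISub r.+2 0 r.+1]).
    by rewrite !all_cat !straight_cexp.
  have [hc0 hc3] : code_at P p (q0 ++ [:: ISub r.+2 0 r.+1]) /\
    code_at P (p + size q0 + 1)
      [:: IJumpZ r.+2 (p + size q0 + 3); IStore r.+1 r].
    have := @code_at_cat P p (q0 ++ [:: ISub r.+2 0 r.+1])
      [:: IJumpZ r.+2 (p + size q0 + 3); IStore r.+1 r].
    by rewrite -catA /= [size (_ ++ [:: _])]size_cat addnA; apply.
  have l q : q < r -> R2 q = R q by move=> hq; rewrite l2 ?l1 //; lia.
  have h0 : R2 0 = L by rewrite l; [case: sR | lia].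
  have E := straightP R M st hc0.
  rewrite xs_cat /q0 xs_cat E1 E2 /xs /= -/q0 in E.
  have [s1 /code_at_cons[s2 _]] := code_at_cons hc3.
  have sz : size (q0 ++ [:: ISub r.+2 0 r.+1]) = size q0 + 1 by rewrite size_cat.
  have szq : size q0 = size (cexp f r) + size (cexp e r.+1) by rewrite size_cat.
  have pcE : (p + size (cexp f r) + size (cexp e r.+1)).+1 = p + size q0 + 1 by lia.
  rewrite pcE sz in E.
  have sR' : simR s (upd R2 r.+2 (L - R2 r.+1)).
    apply: (simR_low sR) => q hq; rewrite updE (l q); last lia.
    by case: eqP => // ?; lia.
  have E' : iter (size q0 + 1) (step P) (Config p R M) =
     Config (p + size q0 + 1) (upd R2 r.+2 (L - R2 r.+1)) M by rewrite E h0.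
  have szF : size (q0 ++ [:: ISub r.+2 0 r.+1; IJumpZ r.+2 (p + size q0 + 3);
                             IStore r.+1 r]) = size q0 + 3 by rewrite size_cat.
  rewrite szF [size (_ ++ _)]size_cat /=.
  have low q : 18 <= q < r -> upd R2 r.+2 (L - R2 r.+1) q = R q.
    by move=> hq; rewrite updE (l q); [case: eqP => // ?; lia | lia].
  have [hlt|hge] := ltnP.
  + exists (size q0 + 1 + 2), (upd R2 r.+2 (L - R2 r.+1)),
      (upd M (ev L e s) (ev L f s)).
    split=> //; first lia.
    * apply: (iter_trans E'); rewrite /= s1 /= updE eqxx v2.
      case: eqP => [?|_]; first lia.
      rewrite s2 /= !updE; do ?case: eqP => [?|_]; try lia.
      by rewrite v2 (l2 r) // v1; congr Config; lia.
    * by move=> a; rewrite flat_setl // updE; case: eqP.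
  + exists (size q0 + 1 + 1), (upd R2 r.+2 (L - R2 r.+1)), M.
    split=> //; first lia.
    apply: (iter_trans E'); rewrite /= s1 /= updE eqxx v2.
    by case: eqP => [_|?]; [congr Config; lia | lia].
- move=> c IHc d IHd r p R M s /andP[wc wd] hr /code_at_cat[hc hd] sR sM.
  have [t1 [R1 [M1 [b1 E1 sR1 sM1 l1]]]] := IHc _ _ _ _ _ wc hr hc sR sM.
  have [t2 [R2 [M2 [b2 E2 sR2 sM2 l2]]]] := IHd _ _ _ _ _ wd hr hd sR1 sM1.
  exists (t1 + t2), R2, M2; split=> //; first lia.
    by rewrite size_cat addnA; apply: iter_trans E1 E2.
  by move=> q hq; rewrite l2 ?l1.
- move=> e c IHc d IHd r p R M s /and3P[we wc wd] hr.
  set p1 := p + size (cexp e r) + 1; set q1 := ccom c p1 r.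
  set p2 := p1 + size q1 + 1; set q2 := ccom d p2 r.
  move=> /code_at_cat[he /code_at_cons[sj]].
  rewrite -addn1 -/p1 => /code_at_cat[hc /code_at_cons[sj2]].
  rewrite -addn1 -/p2 => hd sR sM.
  have [R1 E1 [v1 l1]] := cexpP p we hr sR sM.
  have E := straightP R M (straight_cexp e r) he; rewrite E1 in E.
  have sR1 : simR s R1 by apply: (simR_low sR) => q hq; apply: l1; lia.
  have szE : p + size (cexp e r ++ IJumpZ r p2 :: q1 ++ IJump (p2 + size q2) :: q2)
    = p2 + size q2 by rewrite size_cat /= size_cat /= /p2 /p1; lia.
  rewrite szE; case: eqP => [v0|/eqP nv] /=.
  + have [t2 [R2 [M2 [b2 E2 sR2 sM2 l2]]]] := IHd _ _ _ _ _ wd hr hd sR1 sM.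
    exists (size (cexp e r) + (1 + t2)), R2, M2; split=> //; first lia.
      apply: (iter_trans E); apply: (iter_trans _ E2).
      by rewrite /= sj /= v1 v0.
    by move=> q hq; rewrite l2 // l1 //; lia.
  + have [t2 [R2 [M2 [b2 E2 sR2 sM2 l2]]]] := IHc _ _ _ _ _ wc hr hc sR1 sM.
    exists (size (cexp e r) + (1 + (t2 + 1))), R2, M2; split=> //; first lia.
      apply: (iter_trans E); apply: (@iter_trans _ _ _ _ _ (Config p1 R1 M)).
        by rewrite /= sj /= v1 (negPf nv) /p1 addn1.
      by apply: (iter_trans E2); rewrite /= sj2.
    by move=> q hq; rewrite l2 // l1 //; lia.
- move=> x c IHc r p R M s /andP[wx wc] hr.
  set q := ccom c (p + 5) r.+2.
  set pe := p + 5 + size q + 3.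
  move=> /code_at_cons[s0] /code_at_cons[s1] /code_at_cons[s2].
  move=> /code_at_cons[s3] /code_at_cons[s4].
  have -> : p.+1.+4 = p + 5 by lia.
  move=> /code_at_cat[hc] /code_at_cons[s5] /code_at_cons[s6] /code_at_cons[s7 _].
  move=> sR sM.
  have -> : p + (size (q ++ [:: IConst r.+1 1; IAdd r r r.+1;
    IJump (p + 1)])).+1.+4
    = pe by rewrite size_cat /= /pe; lia.
  (* The invariant is stated at the loop test, at position [p + 1], after m turns. *)
  have key m : m <= n -> exists t R' M', [/\ t <= m * (cost c r.+2 + 7) + 1,
      iter t (step P) (Config p R M) = Config (p + 1) R' M',
      simR (iteri m (fun i s => run n L c (setv s x i)) s) R',
      simM (iteri m (fun i s => run n L c (setv s x i)) s) M'
      & R' r = m /\ forall q, 18 <= q < r -> R' q = R q].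
    elim: m => [_|m IHm hm].
      exists 1, (upd R r 0), M; rewrite /= s0 /=; split=> //.
      + by rewrite addn1.
      + apply: (simR_low sR) => i hi; rewrite updE; case: eqP => ? //; lia.
      + rewrite updE eqxx; split=> // i hi; rewrite updE; case: eqP => ? //;
        lia.
    have [t [R1 [M1 [b1 E1 sR1 sM1 [v1 l1]]]]] := IHm (ltnW hm).
    move: sR1 sM1; set sm := iteri m _ s => sR1 sM1.
    pose R2 := upd (upd (upd R1 r.+1 (n - m)) r.+1 0) x.+2 m.
    have sR2 : simR (setv sm x m) R2.
      have [h0 h1 h2] := sR1; rewrite /R2; split; rewrite ?updE /= ?h0 ?h1 //;
        try by do ?case: eqP => ? //; lia.
      move=> y hy; rewrite !updE !eqSS; case: (y == x) => //.
      by do ?case: eqP => ?; rewrite ?h2 //; lia.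
    have E2 : iter 4 (step P) (Config (p + 1) R1 M1) = Config (p + 5) R2 M1.
      have [_ h1 _] := sR1.
      have -> : p + 1 = p.+1 by lia.
      have -> : p + 5 = p.+1.+4 by lia.
      rewrite /= s1 /= s2 /= updE eqxx h1 v1.
      case: eqP => [?|_]; first lia.
      rewrite s3 /= s4 /=; congr Config; rewrite /R2.
      set R' := upd (upd R1 _ _) _ 0.
      have -> : R' r + R' r.+1 = m by rewrite /R' !updE; do ?case: eqP => ?;
        lia.
      by [].
    have hr2 : 18 <= r.+2 by lia.
    have [t3 [R3 [M3 [b3 E3 sR3 sM3 l3]]]] := IHc _ _ _ _ _ wc hr2 hc sR2 sM1.
    pose R4 := upd (upd R3 r.+1 1) r m.+1.
    exists (t + (4 + (t3 + 3))), R4, M3; rewrite iteriS -/sm; split=> //.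
    + lia.
    + apply: (iter_trans E1); apply: (iter_trans E2); apply: (iter_trans E3).
      rewrite /= s5 /= s6 /= s7 /=; congr Config; rewrite /R4.
      set R' := upd R3 _ 1.
      have e3 : R3 r = m.
        by rewrite l3; [rewrite /R2 !updE; do ?case: eqP => ?; lia | lia].
      have -> : R' r + R' r.+1 = m.+1.
        by rewrite /R' !updE e3; do ?case: eqP => ?; lia.
      by [].
    + by apply: (simR_low sR3) => i hi; rewrite /R4 !updE; do ?case: eqP => ?;
      lia.
    + rewrite /R4 updE eqxx; split=> // i hi; rewrite !updE -l1 // l3; last lia.
      by rewrite /R2 !updE; do ?case: eqP => ?; lia.
  have [t [R1 [M1 [b1 E1 sR1 sM1 [v1 l1]]]]] := key n (leqnn n).
  exists (t + 2), (upd R1 r.+1 0), M1; split=> //; first lia.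
  + apply: (iter_trans E1); have [_ h1 _] := sR1.
    have -> : p + 1 = p.+1 by lia.
    rewrite /= s1 /= s2 /= updE eqxx h1 v1 subnn eqxx //.
  + by apply: (simR_low sR1) => i hi; rewrite updE; case: eqP => ?; lia.
  + by move=> i hi; rewrite updE -l1 //; case: eqP => ?; lia.
Qed.

(** * Polynomial running time *)

Fixpoint loops (c : com) : nat :=
  match c with
  | Seq c d | If _ c d => maxn (loops c) (loops d)
  | For _ c => (loops c).+1
  | _ => 0
  end.

(** The coefficient of the polynomial bound on [cost]; the 10 is the loop overhead 7 + 3. *)
Fixpoint weight (c : com) (r : nat) : nat :=
  match c with
  | Seq c d => weight c r + weight d r
  | If e c d => size (cexp e r) + (weight c r + weight d r + 2)
  | For x c => weight c r.+2 + 10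
  | _ => size (ccom c 0 r)
  end.

Lemma cost_le c r : cost c r <= weight c r * n.+1 ^ loops c.
Proof.
elim: c r => //=; try by move=> *; rewrite muln1.
- move=> c IHc d IHd r.
  have hc := leq_pexp2l (ltn0Sn n) (leq_maxl (loops c) (loops d)).
  have hd := leq_pexp2l (ltn0Sn n) (leq_maxr (loops c) (loops d)).
  by have := IHc r; have := IHd r; nia.
- move=> e c IHc d IHd r.
  have m1 : 0 < n.+1 ^ maxn (loops c) (loops d) by rewrite expn_gt0.
  have hc := leq_pexp2l (ltn0Sn n) (leq_maxl (loops c) (loops d)).
  have hd := leq_pexp2l (ltn0Sn n) (leq_maxr (loops c) (loops d)).
  have {}hc := leq_trans (IHc r) (leq_mul (leqnn _) hc).
  have {}hd := leq_trans (IHd r) (leq_mul (leqnn _) hd).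
  by nia.
- move=> x c IHc r; rewrite expnS.
  have m1 : 0 < n.+1 ^ loops c by rewrite expn_gt0.
  by have := IHc r.+2; nia.
Qed.

End Simulation.

Definition start (w : seq nat) : store :=
  Store (fun=> 0) (fun _ _ => 0) (nth 0 w).

(** The word has to begin with the loop bound n, and n < size w turns powers of n + 1 into powers of
    the input length. The output must fit into the input cells, since beyond them memory is
    interleaved arrays. *)
Lemma com_computable (c : com) (o : nat) :
  wfc c -> o < 16 -> exists P C d, forall w,
    nth 0 w 0 < size w ->
    let s := run (nth 0 w 0) (size w) c (start w) in
    va s o <= size w ->
    computes_within P w (mkseq (lo s) (va s o)) (C * size w ^ d + C).
Proof.
move=> wc ho.
pose q := ccom c 2 18.
(* The two leading instructions load n from cell 0 into register 1, the two trailing ones put the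
   output length into register 0; these account for the 4 in the bound. *)
exists ([:: IConst 1 0; ILoad 1 1] ++ q ++ [:: IConst 18 0; IAdd 0 o.+2 18]).
exists (weight c 18 + 4), (loops c) => w hn.
set P := _ ++ q ++ _; set n := nth 0 w 0; set L := size w => s hs.
have hP : code_at P 0 P by exists [::], [::]; rewrite cats0.
have [s0 /code_at_cons[s1 /code_at_cat[hc /code_at_cons[s2 /code_at_cons[s3 _]]]]]
  := code_at_cons hP.
have hc' : code_at P 2 (ccom c 2 18) by [].
pose R0 := upd (upd (upd (fun=> 0) 0 L) 1 0) 1 n.
have E0 : iter 2 (step P) (init w) = Config 2 R0 (nth 0 w).
  by rewrite /= /init s0 /= s1.
have sR0 : simR n L (start w) R0 by [].
have sM0 : simM L (start w) (nth 0 w).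
  move=> a; rewrite /flat /=; case: ltnP => // h; exact: nth_default.
have [t [R1 [M1 [b1 E1 [h0 h1 h2] sM1 _]]]] :=
  ccomP wc (leqnn 18) hc' sR0 sM0.
have E2 : iter 2 (step P) (Config (2 + size q) R1 M1) =
    Config (size P) (upd (upd R1 18 0) 0 (va s o)) M1.
  rewrite /= s2 /= s3 /=; congr Config; first by rewrite /P !size_cat /=; lia.
  by rewrite ![upd _ 18 _ _]updE /= !eqSS; case: eqP => [?|_];
    [lia | rewrite h2 // addn0].
have E := iter_trans (iter_trans E0 E1) E2.
have fin m cf : size P <= pc cf -> iter m (step P) cf = cf.
  by move=> h; elim: m => //= m ->; rewrite /step /halted h.
have tb : 2 + t + 2 <= (weight c 18 + 4) * L ^ loops c + (weight c 18 + 4).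
  have hw := leq_trans b1 (cost_le n c 18).
  have hp : n.+1 ^ loops c <= L ^ loops c by case: (loops c) => // m;
    rewrite leq_exp2r.
  by have := leq_trans hw (leq_mul (leqnn _) hp); nia.
rewrite /computes_within -(subnK tb) iterD E fin //.
split; first exact: leqnn.
apply: (@eq_from_nth _ 0); rewrite !size_mkseq //= => i hi.
by rewrite !nth_mkseq //= sM1 /flat (leq_trans hi hs).
Qed.

(** * Saturating loops *)

Section Saturation.

Variables (n L : nat) (Inv : (nat -> nat -> nat) -> Prop).
Variable mu : (nat -> nat -> nat) -> nat.
Hypothesis mu_le : forall a, Inv a -> mu a <= n.

(** A run either finds nothing to do or raises the measure, and an idle state is a fixed point. All
    this refers to the arrays alone, because loop variables change even when nothing happens. *)
Definition progresses (ctx : store -> Prop) (c : com)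
    (idle : (nat -> nat -> nat) -> Prop) : Prop :=
  forall s, ctx s -> Inv (ar s) ->
    let s' := run n L c s in
    [/\ ctx s', Inv (ar s'), idle (ar s) -> ar s' = ar s
      & ar s' = ar s /\ idle (ar s) \/ mu (ar s) < mu (ar s')].

Definition ignores (ctx : store -> Prop) (x : nat) : Prop :=
  forall s v, ctx s -> ctx (setv s x v).

Lemma progresses_if ctx e c (G : (nat -> nat -> nat) -> bool) :
  (forall s, ctx s -> Inv (ar s) -> (ev L e s != 0) = G (ar s)) ->
  (forall s, ctx s -> Inv (ar s) -> G (ar s) ->
    let s' := run n L c s in
    [/\ ctx s', Inv (ar s') & mu (ar s) < mu (ar s')]) ->
  progresses ctx (If e c Skip) (fun a => ~~ G a).
Proof.
move=> hG hc s cs Is /=; rewrite hG //.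
case: ifPn => g; last by split=> //; left.
by have [h1 h2 h3] := hc s cs Is g; split=> //; right.
Qed.

(** No turn lowers the measure, so one effective turn makes the whole loop effective; if no turn is
    effective, all of them saw the same arrays and found them idle. *)
Lemma progresses_for ctx x c (idle : nat -> (nat -> nat -> nat) -> Prop) :
  ignores ctx x ->
  (forall i, i < n -> progresses (fun s => ctx s /\ va s x = i) c (idle i)) ->
  progresses ctx (For x c) (fun a => forall i, i < n -> idle i a).
Proof.
move=> ign hc s cs Is /=.
have key m : m <= n ->
    let s' := iteri m (fun i s => run n L c (setv s x i)) s in
    [/\ ctx s', Inv (ar s'),
      (forall i, i < m -> idle i (ar s)) -> ar s' = ar s
      & ar s' = ar s /\ (forall i, i < m -> idle i (ar s))
        \/ mu (ar s) < mu (ar s')].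
  elim: m => [|m IH] hm /=; first by split=> //; left.
  have [c1 I1 id1 d1] := IH (ltnW hm); move: c1 I1 id1 d1.
  set s1 := iteri m _ s => c1 I1 id1 d1.
  have cx : ctx (setv s1 x m) /\ va (setv s1 x m) x = m.
    by split; [apply: ign | rewrite /= /upd eqxx].
  have [[c2 _] I2 id2 d2] := hc m hm _ cx I1.
  rewrite /= in I2 id2 d2.
  split=> //.
    move=> h; have E1 : ar s1 = ar s by apply: id1 => i hi; apply/h/leqW.
    by rewrite id2 // E1; apply: h.
  case: d1 => [[E1 h1]|lt1]; case: d2 => [[E2 h2]|lt2].
  - left; split; first by rewrite E2.
    move=> i; rewrite ltnS leq_eqVlt => /orP[/eqP->|]; last exact: h1.
    by rewrite -E1.
  - by right; rewrite -E1.
  - by right; rewrite E2.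
  - by right; apply: ltn_trans lt2.
exact: key.
Qed.

(** If the state is not idle after n turns, each turn has raised the measure, which is then at least
    n; a virtual further turn would push it past its bound. *)
Lemma saturates ctx x c idle s :
  ignores ctx x -> progresses ctx c idle -> ctx s -> Inv (ar s) ->
  let s' := run n L (For x c) s in [/\ ctx s', Inv (ar s') & idle (ar s')].
Proof.
move=> ign hc cs Is /=.
have key m : let s' := iteri m (fun i s => run n L c (setv s x i)) s in
    [/\ ctx s', Inv (ar s') & idle (ar s') \/ m <= mu (ar s')].
  elim: m => [|m [c1 I1 d1]] /=; first by split=> //; right.
  move: c1 I1 d1; set s1 := iteri m _ s => c1 I1 d1.
  have [c2 I2 id2 d2] := hc _ (ign s1 m c1) I1.
  rewrite /= in I2 id2 d2.
  split=> //; case: d1 => [id|le].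
    by left; rewrite id2.
  case: d2 => [[E id]|lt]; first by left; rewrite E.
  by right; apply: leq_ltn_trans lt.
have [c1 I1 [id|le]] := key n; split=> //.
have [_ I2 _ [[//]|lt]] := hc _ c1 I1.
by have := leq_ltn_trans le lt; rewrite ltnNge mu_le.
Qed.

Definition sat2 (p u w : nat) (e : exp) (c : com) : com :=
  For p (For u (For w (If e c Skip))).

(** [G] is the guard read as a property of the arrays. The body must leave the variables alone
    because the innermost sweep relies on [u] keeping its value. *)
Lemma sat2P (ctx : store -> Prop) p u w e c
    (G : (nat -> nat -> nat) -> nat -> nat -> bool) s :
  u != w -> ignores ctx p -> ignores ctx u -> ignores ctx w ->
  (forall s, ctx s -> Inv (ar s) -> va s u < n -> va s w < n ->
    (ev L e s != 0) = G (ar s) (va s u) (va s w)) ->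
  (forall s, ctx s -> Inv (ar s) -> va s u < n -> va s w < n ->
    G (ar s) (va s u) (va s w) ->
    let s' := run n L c s in
    [/\ ctx s', Inv (ar s'), mu (ar s) < mu (ar s') & va s' = va s]) ->
  ctx s -> Inv (ar s) ->
  let s' := run n L (sat2 p u w e c) s in
  [/\ ctx s', Inv (ar s') & forall i i', i < n -> i' < n -> ~~ G (ar s') i i'].
Proof.
move=> uw ip iu iw hG hc cs Is.
have := @saturates ctx p (For u (For w (If e c Skip)))
  (fun a => forall i, i < n -> forall i', i' < n -> ~~ G a i i') s ip _ cs Is.
case=> [|h1 h2 h3]; last by split=> // i i' hi; apply: h3.
apply: progresses_for => // i hi.
apply: progresses_for => [s1 v [c1 v1]|i' hi'].
  by split; [apply: iw | rewrite /= /upd (negPf uw)].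
apply: progresses_if => s1 [[c1 v1] v2] I1; rewrite -v1 -v2 in hi hi' *.
  exact: hG.
move=> g; have [h1 h2 h3 h4] := hc s1 c1 I1 hi hi' g.
by split; rewrite ?h4.
Qed.

End Saturation.

(** * The program *)

Declare Scope exp_scope.
Delimit Scope exp_scope with E.
Bind Scope exp_scope with exp.
Coercion EC : nat >-> exp.
Notation "e + f" := (EAdd e f) : exp_scope.
Notation "e - f" := (ESub e f) : exp_scope.
Notation "e == f" := (EEq e f) : exp_scope.
Notation "e < f" := (ELt e f) : exp_scope.
Notation "e && f" := (EAnd e f) : exp_scope.
Notation "~~ e" := (ENot e) : exp_scope.
Notation "t @[ e ]" := (EA t e%E) (at level 2, format "t @[ e ]") : exp_scope.
Notation "$ x" := (EV x) (at level 1, format "$ x") : exp_scope.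
Notation "x ::= e" := (SetV x e%E) (at level 85, no associativity).
Notation "t @[ i ] ::= e" := (SetA t i%E e%E)
  (at level 2, i at level 200, e at level 80).
Notation "c ;; d" := (Seq c d) (at level 86, right associativity).

(* Terminals are numbered from 1, both as indices and as contents, so that 0
   means none; vertices and parts are numbered from 0. MUL i = i n gives row
   offsets. DOM x is the part of the vertex x. SZ, HOME and TERM give the
   target, the part and the vertex of a terminal. SIG is a matching of terminals
   to parts, TAK its image, and GRP b the part containing the terminal matched
   to b. SOL marks the finished groups and RES x is the class of x in the answer.
   The other arrays only concern the current group: HOLD x is the terminal
   holding x and CNT s the number of vertices held by s; FIX marks the vertices
   that may attract others; OWN b is the terminal pulling from the part b, and
   HAS s tells whether s pulls from some part; FC s is the number of x with
   RES x = s. *)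
Notation MUL := 0 (only parsing).
Notation DOM := 1 (only parsing).
Notation SZ := 2 (only parsing).
Notation HOME := 3 (only parsing).
Notation TERM := 4 (only parsing).
Notation GRP := 5 (only parsing).
Notation SIG := 6 (only parsing).
Notation TAK := 7 (only parsing).
Notation SOL := 8 (only parsing).
Notation RES := 9 (only parsing).
Notation HOLD := 10 (only parsing).
Notation FIX := 11 (only parsing).
Notation CNT := 12 (only parsing).
Notation OWN := 13 (only parsing).
Notation HAS := 14 (only parsing).
Notation FC := 15 (only parsing).

Notation vU := 0 (only parsing).
Notation vW := 1 (only parsing).
Notation vP := 2 (only parsing).
Notation vJ := 3 (only parsing).
Notation vK := 4 (only parsing).
Notation vA := 5 (only parsing).
Notation vB := 6 (only parsing).
Notation vQ := 7 (only parsing).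
Notation vO := 8 (only parsing).

Notation When e c := (If e%E c Skip).

Definition edge : exp := EM (2 + (MUL@[$vU] + $vW))%E.

Definition p_mul : com := For vU (MUL@[$vU + 1] ::= MUL@[$vU] + EM 0).

Definition p_dom : com :=
  For vU (For vW (When (($vU < $vK) &&
      EM (2 + (MUL@[EM 0] + ($vK + ($vK + (MUL@[$vU] + $vW))))))
    (DOM@[$vW] ::= $vU))).

Definition p_term : com :=
  For vU (When ($vU < $vK)
    (SZ@[$vU + 1] ::= EM (2 + (MUL@[EM 0] + ($vK + $vU))) ;;
     TERM@[$vU + 1] ::= EM (2 + (MUL@[EM 0] + $vU)) ;;
     HOME@[$vU + 1] ::= DOM@[TERM@[$vU + 1]])).

Definition g_match : exp :=
  (($vU < $vK) && (($vW < $vK) && ((SIG@[$vU + 1] == 0) && (TAK@[$vW] == 0))))%E.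

Definition c_match : com :=
  SIG@[$vU + 1] ::= $vW + 1 ;; TAK@[$vW] ::= 1 ;; GRP@[$vW] ::= HOME@[$vU + 1].

Definition p_match : com :=
  sat2 vP vU vW (g_match && (HOME@[$vU + 1] == $vW))%E c_match ;;
  sat2 vP vU vW g_match c_match.

Definition p_clear : com :=
  For vU (HOLD@[$vU] ::= 0 ;; FIX@[$vU] ::= 0 ;; OWN@[$vU] ::= 0 ;;
          HAS@[$vU + 1] ::= 0).

Definition p_seed : com :=
  For vU (When (($vU < $vK) && (HOME@[$vU + 1] == $vJ))
    (HOLD@[TERM@[$vU + 1]] ::= $vU + 1 ;; FIX@[TERM@[$vU + 1]] ::= 1 ;;
     RES@[TERM@[$vU + 1]] ::= $vU + 1 ;;
     CNT@[$vU + 1] ::= 1 ;; FC@[$vU + 1] ::= 1)).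

Definition g_colour : exp :=
  (FIX@[$vU] && ((HOLD@[$vW] == 0) && ((GRP@[DOM@[$vW]] == $vJ) && edge)))%E.

(** Only base vertices become marked: a vertex outside the base is held, but it attracts nothing, so
    it hangs directly on a base piece. *)
Definition c_colour : com :=
  HOLD@[$vW] ::= HOLD@[$vU] ;;
  FIX@[$vW] ::= (DOM@[$vW] == $vJ) ;;
  CNT@[HOLD@[$vU]] ::= CNT@[HOLD@[$vU]] + 1.

(** The sum of two truth values serves as a disjunction: either the part of w already belongs to the
    holder of u, or it is free and this holder owns no part. *)
Definition g_pull : exp :=
  (FIX@[$vU] && ((FIX@[$vW] == 0) && ((GRP@[DOM@[$vW]] == $vJ) && (edge &&
   ((CNT@[HOLD@[$vU]] < SZ@[HOLD@[$vU]]) &&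
    ((OWN@[DOM@[$vW]] == HOLD@[$vU]) +
     ((OWN@[DOM@[$vW]] == 0) && (HAS@[HOLD@[$vU]] == 0))))))))%E.

(** [HOLD] changes last, since the first counter update refers to the old holder of w. If the puller
    already holds w, the counter updates cancel and the move merely fixes w. *)
Definition c_pull : com :=
  CNT@[HOLD@[$vW]] ::= CNT@[HOLD@[$vW]] - 1 ;;
  CNT@[HOLD@[$vU]] ::= CNT@[HOLD@[$vU]] + 1 ;;
  OWN@[DOM@[$vW]] ::= HOLD@[$vU] ;;
  HAS@[HOLD@[$vU]] ::= 1 ;;
  FIX@[$vW] ::= 1 ;;
  HOLD@[$vW] ::= HOLD@[$vU].

(** [RES] also contains the classes of groups served earlier; the test on [HOME] keeps these from
    growing. *)
Definition g_grow : exp :=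
  (RES@[$vU] && ((RES@[$vW] == 0) && ((GRP@[DOM@[$vW]] == $vJ) &&
   ((HOME@[RES@[$vU]] == $vJ) && (edge && (FC@[RES@[$vU]] < SZ@[RES@[$vU]]))))))%E.

Definition c_grow : com :=
  FC@[RES@[$vU]] ::= FC@[RES@[$vU]] + 1 ;;
  RES@[$vW] ::= RES@[$vU].

Definition p_next : com :=
  For vU (When (($vU < $vK) && ((GRP@[$vU] == $vU) && (SOL@[$vU] == 0)))
    (vQ ::= $vU)).

(** [SOL] is set before the search, so that the group just served is not found again. The initial
    value k of [vQ] stands for no open group; by counting, no vertex is then left over. *)
Definition p_left : com :=
  SOL@[$vJ] ::= 1 ;; vQ ::= $vK ;; p_next ;;
  For vW (When ((GRP@[DOM@[$vW]] == $vJ) && (RES@[$vW] == 0))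
    (DOM@[$vW] ::= $vQ)).

Definition p_group : com :=
  p_clear ;; p_seed ;;
  sat2 vP vU vW g_colour c_colour ;;
  sat2 vP vU vW g_pull c_pull ;;
  sat2 vP vU vW (g_grow && (HOLD@[$vW] == RES@[$vU]))%E c_grow ;;
  sat2 vP vU vW g_grow c_grow.

Definition p_solve : com := p_group ;; p_left.

Definition p_region : com :=
  For vU (When (GRP@[DOM@[$vU]] == $vJ) (vA ::= $vA + 1)).

Definition p_need : com :=
  For vU (When (($vU < $vK) && (HOME@[$vU + 1] == $vJ))
    (vB ::= $vB + SZ@[$vU + 1])).

Definition p_count : com := vA ::= 0 ;; vB ::= 0 ;; p_region ;; p_need.

Definition g_main : exp :=
  (($vJ < $vK) && ((GRP@[$vJ] == $vJ) && (SOL@[$vJ] == 0)))%E.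

Definition p_step : com :=
  When g_main (p_count ;; If ($vA < $vB)%E Skip p_solve).

Definition p_main : com := For vP (For vJ p_step).

(** The answer overwrites the input: what is still needed has been copied to arrays and variables,
    and a matrix of k n cells fits there. *)
Definition p_write : com :=
  For vU (For vW (When ($vU < $vK)
    (SetM (MUL@[$vU] + $vW)%E (RES@[$vW] == $vU + 1)%E))).

Definition p_out : com := p_write ;; vO ::= MUL@[$vK].

Definition gl_com : com :=
  vK ::= EM 1 ;; p_mul ;; p_dom ;; p_term ;; p_match ;; p_main ;; p_out.

Lemma wf_gl_com : wfc gl_com.
Proof. by []. Qed.

(** * Colouring, pulling and growing *)

Section Connectivity.

Variable G : graph.
Implicit Types (S F : {set G}) (x y u w : G).

Lemma connected1 x : induced_connected [set x].
Proof. by move=> y z /set1P-> /set1P->; apply: connect0. Qed.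

Lemma connect_induced_sym S : connect_sym (induced S).
Proof.
apply: sym_connect_sym => x y; rewrite /induced /= adj_sym.
by rewrite andbCA.
Qed.

Lemma connect_inducedS S F : S \subset F ->
  subrel (connect (induced S)) (connect (induced F)).
Proof.
move=> /subsetP h; apply: connect_sub => x y /and3P[xS yS xy].
by apply: connect1; apply/and3P; split=> //; apply: h.
Qed.

(** A connected core with further vertices attached to it one by one. Such pendant vertices can be
    withdrawn individually without disconnecting the rest, which is what makes taking over
    harmless. *)
Lemma connected_pendant S F :
  S \subset F -> induced_connected S ->
  (forall x, x \in F -> x \notin S -> exists2 u, u \in S & adj u x) ->
  induced_connected F.
Proof.
move=> sSF cS hF.
have key x : x \in F -> exists2 u, u \in S & connect (induced F) u x.
  move=> xF; have [xS|xS] := boolP (x \in S).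
    by exists x; rewrite ?connect0.
  have [u uS ux] := hF x xF xS; exists u => //.
  by apply: connect1; apply/and3P; split=> //; apply: (subsetP sSF).
move=> x y /key[u uS ux] /key[v vS vy].
rewrite connect_induced_sym in ux; apply: connect_trans ux _.
by apply: connect_trans vy; apply: connect_inducedS sSF _ _ (cS _ _ uS vS).
Qed.

Lemma connectedU1 S u w :
  induced_connected S -> u \in S -> adj u w -> induced_connected (w |: S).
Proof.
move=> cS uS uw; apply: (connected_pendant _ cS); first exact: subsetUr.
by move=> x /setU1P[->|->] // _; exists u.
Qed.

(** The first edge leaving [F] on a path from x to y. In this form connectivity supplies an
    applicable move. *)
Lemma connected_boundary S F x y :
  induced_connected S -> x \in S -> x \in F -> y \in S -> y \notin F ->
  exists u w, [/\ u \in S, u \in F, w \in S, w \notin F & adj u w].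
Proof.
move=> cS xS xF yS yF; have /connectP[p] := cS x y xS yS.
elim: p x xS xF => [|z p IH] x xS xF /=; first by move=> _ E;
  rewrite E xF in yF.
move=> /andP[/and3P[_ zS xz] hp] E.
by have [zF|zF] := boolP (z \in F); [apply: IH E | exists x, z].
Qed.

End Connectivity.

(** * The moves within one group *)

Section Rules.

Variables (G : graph) (k : nat).

Definition class (f : G -> option 'I_k) (s : 'I_k) : {set G} :=
  [set x | f x == Some s].

Definition upd_at (T : eqType) (R : Type) (f : T -> R) (w : T) (v : R) : T -> R :=
  fun x => if x == w then v else f x.

Lemma card_partition (f : G -> option 'I_k) (X : {set G}) (S : {set 'I_k}) :
  (forall x, x \in X -> exists2 s, s \in S & f x = Some s) ->
  (forall x s, s \in S -> f x = Some s -> x \in X) ->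
  #|X| = \sum_(s in S) #|class f s|.
Proof.
move=> hX hS;
  rewrite -sum1_card (partition_big f (mem [set Some s | s in S])) /=;
    last first.
  by move=> x /hX[s sS ->]; apply: imset_f.
rewrite big_imset /=; last by move=> s t _ _ [].
apply: eq_bigr => s sS; rewrite -sum1_card; apply: eq_bigl => x.
by rewrite inE andb_idl // => /eqP /hS; apply.
Qed.

Lemma class_upd_at f w s t : f w <> Some t ->
  class (upd_at f w (Some s)) t = if s == t then w |: class f t else class f t.
Proof.
move=> fw; apply/setP=> x; rewrite /class /upd_at.
case: (eqVneq s t) => [->|ne]; rewrite !inE; case: (eqVneq x w) => [->|//=].
  by rewrite eqxx.
by rewrite (inj_eq Some_inj) (negPf ne); apply/esym/eqP.
Qed.

Section Group.

(* [d x] is the part containing the vertex x, [home s] the part containing the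
   terminal s, and [grp b] the home part that b serves: as many parts as
   terminals share the value j. *)
Variables (c : 'I_k -> G) (N : 'I_k -> nat).
Variables (home grp : 'I_k -> 'I_k) (d : G -> 'I_k) (j : 'I_k).

Definition part (b : 'I_k) : {set G} := [set x | d x == b].
Definition region : {set G} := [set x | grp (d x) == j].
Definition mates : {set 'I_k} := [set s | home s == j].

Hypothesis c_inj : injective c.
Hypothesis N_gt0 : forall s, 0 < N s.
Hypothesis grp_j : grp j = j.
Hypothesis mates_neq0 : exists s, home s = j.
Hypothesis card_mates : #|[set b | grp b == j]| = #|mates|.
Hypothesis cds_part : forall b, grp b = j -> cds (part b).
Hypothesis d_c : forall s, home s = j -> d (c s) = j.
Hypothesis size_region : \sum_(s in mates) N s <= #|region|.

(** Connectivity is asked only of the trace of a class on the base; every other vertex of the class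
    is pendant on this trace. *)
Record colouring (hold : G -> option 'I_k) : Prop := Colouring {
  col_home : forall x s, hold x = Some s -> home s = j /\ grp (d x) = j;
  col_term : forall s, home s = j -> hold (c s) = Some s;
  col_conn : forall s, home s = j ->
    induced_connected (class hold s :&: part j);
  col_att : forall x s, hold x = Some s -> d x <> j ->
    exists u, [/\ d u = j, hold u = Some s & adj u x] }.

Lemma colouring0 hold :
  (forall s, home s = j -> hold (c s) = Some s) ->
  (forall x s, hold x = Some s -> home s = j /\ x = c s) ->
  colouring hold.
Proof.
move=> h1 h2; split=> //.
- by move=> x s /h2[hs ->]; rewrite d_c.
- move=> s hs;
  suff -> : class hold s :&: part j = [set c s] by apply: connected1.
  apply/setP=> x; rewrite !inE; apply/andP/eqP => [[/eqP/h2[_ ->//] _]|->].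
  by rewrite h1 ?d_c ?eqxx.
- by move=> x s /h2[hs ->]; rewrite d_c.
Qed.

Lemma colouring_step hold u w s :
  colouring hold -> d u = j -> hold u = Some s -> hold w = None ->
  grp (d w) = j -> adj u w -> colouring (upd_at hold w (Some s)).
Proof.
move=> [h1 h2 h3 h4] du hu hw gw uw.
have [hs _] := h1 _ _ hu.
have uNw : u <> w by move=> E; rewrite E hw in hu.
have uw' : (u == w) = false by apply/eqP.
split.
- by move=> x t; rewrite /upd_at; case: eqP => [-> [<-]|_ /h1].
- by move=> t ht; rewrite /upd_at; case: eqP => [E|_];
  rewrite ?h2 // -E h2 in hw *.
- move=> t ht; rewrite class_upd_at ?hw //.
  case: eqP => [<-|_]; last exact: h3.
  rewrite setIUl; case: (eqVneq (d w) j) => dw.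
    rewrite (setIidPl _); last by rewrite sub1set inE dw.
    by apply: (connectedU1 (u := u)) => //;
      [apply: h3 | rewrite !inE hu du !eqxx].
  suff -> : [set w] :&: part j = set0 by rewrite set0U; apply: h3.
  by apply/setP=> x; rewrite !inE; case: eqP => // ->; rewrite (negPf dw).
- move=> x t; rewrite /upd_at; case: eqP => [-> [<-] _|_ hx dx].
    by exists u; rewrite uw'.
  have [v [dv hv vx]] := h4 _ _ hx dx; exists v.
  by case: eqP => [E|_] //; rewrite -E hv in hw.
Qed.

(** The base is connected and contains a held terminal, so an unheld base vertex would give an edge
    from a held to an unheld one. Once the base is held, domination gives every other vertex of the
    region a held neighbour. *)
Lemma colouring_total hold :
  colouring hold ->
  (forall u w s, d u = j -> hold u = Some s -> hold w = None ->
    grp (d w) = j -> adj u w -> False) ->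
  forall x, grp (d x) = j -> hold x <> None.
Proof.
move=> [h1 h2 h3 h4] stuck.
have tot x : d x = j -> hold x <> None.
  move=> dx hx; have [s hs] := mates_neq0.
  have [_ cj _] := cds_part grp_j.
  have [||||u [w []]] := @connected_boundary _ _ [set x | hold x != None] (c s) x cj.
  - by rewrite inE d_c.
  - by rewrite inE h2.
  - by rewrite inE dx.
  - by rewrite inE hx.
  rewrite !inE => /eqP du; case hu: (hold u) => [t|//] _ /eqP dw.
  rewrite negbK => /eqP hw uw.
  by apply: (stuck u w t) => //; rewrite dw.
move=> x gx hx; have [_ _ dom] := cds_part grp_j.
have [dx|dx] := eqVneq (d x) j; first exact: (tot x).
have [|u] := dom x; first by rewrite inE.
rewrite inE => /eqP du xu.
case hu: (hold u) => [t|]; last exact: (tot u).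
by apply: (stuck u x t); rewrite // adj_sym.
Qed.

(* A terminal owning a part never exceeds its target, so a terminal that is
   short of vertices while all parts of the group belong to others would make
   the region too small. *)
Record pulling (hold : G -> option 'I_k) (fix_ : pred G)
    (own : 'I_k -> option 'I_k) : Prop := Pulling {
  pul_home : forall x s, hold x = Some s -> home s = j /\ grp (d x) = j;
  pul_total : forall x, grp (d x) = j -> hold x <> None;
  pul_base : forall x, d x = j -> fix_ x;
  pul_own : forall x, fix_ x -> d x <> j -> own (d x) = hold x;
  pul_fix : forall x, fix_ x -> grp (d x) = j;
  pul_owner : forall b s, own b = Some s ->
    [/\ b <> j, grp b = j, home s = j & #|class hold s| <= N s];
  pul_inj : forall b b' s, own b = Some s -> own b' = Some s -> b = b';
  pul_term : forall s, home s = j -> hold (c s) = Some s;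
  pul_conn : forall s, home s = j ->
    induced_connected (class hold s :&: [set x | fix_ x]);
  pul_att : forall x s, hold x = Some s -> ~~ fix_ x ->
    exists u, [/\ d u = j, hold u = Some s & adj u x] }.

Definition can_pull hold (fix_ : pred G) (own : 'I_k -> option 'I_k) u w s :=
  [/\ [/\ fix_ u, ~~ fix_ w & grp (d w) = j], hold u = Some s, adj u w,
      #|class hold s| < N s
    & own (d w) = Some s \/ own (d w) = None /\ forall b, own b <> Some s].

Lemma pulling0 hold :
  colouring hold -> (forall x, grp (d x) = j -> hold x <> None) ->
  pulling hold (mem (part j)) (fun=> None).
Proof.
move=> [h1 h2 h3 h4] tot; split=> //=.
- by move=> x; rewrite !inE => ->.
- by move=> x; rewrite !inE => /eqP.
- by move=> x; rewrite !inE => /eqP ->.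
- by move=> s hs; have := h3 s hs; congr induced_connected; apply/setP=> x;
  rewrite !inE.
- by move=> x s hx; rewrite inE => /eqP dx; apply: h4.
Qed.

(** Only unfixed vertices change hands, so the connected fixed part of a class never loses a vertex.
    Classes other than that of s can only shrink, and s was strictly below its target; hence owners
    stay within their targets. *)
Lemma pulling_step hold fix_ own u w s :
  pulling hold fix_ own -> can_pull hold fix_ own u w s ->
  pulling (upd_at hold w (Some s)) (upd_at fix_ w true)
    (upd_at own (d w) (Some s)).
Proof.
move=> [h1 h2 h3 h4 h5 h6 h7 h8 h9 h10] [[fu fw gw] hu uw lt ow].
have [hs _] := h1 _ _ hu.
have dw : d w <> j by move=> /h3; apply/negP.
have base x : d x = j -> (x == w) = false by move=> E; apply/eqP=> Ew;
  rewrite -Ew in dw.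
have sub t : t != s -> class (upd_at hold w (Some s)) t \subset class hold t.
  move=> ts; apply/subsetP=> x; rewrite !inE /upd_at; case: (x == w) => //.
  by rewrite (inj_eq Some_inj) eq_sym (negPf ts).
have subs : class (upd_at hold w (Some s)) s \subset w |: class hold s.
  by apply/subsetP=> x; rewrite !inE /upd_at; case: (x == w).
have cards : #|class (upd_at hold w (Some s)) s| <= N s.
  apply: leq_trans (subset_leq_card subs) _; apply: leq_trans lt.
  by rewrite cardsU1; case: (w \notin _).
split.
- by move=> x t; rewrite /upd_at; case: eqP => [-> [<-]|_ /h1].
- by move=> x gx; rewrite /upd_at; case: eqP => // _; apply: h2.
- by move=> x dx; rewrite /upd_at base // h3.
- move=> x; rewrite /upd_at; case: (eqVneq x w) => [->|xw] fx dx;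
  first by rewrite eqxx.
  case: eqP => [E|_]; last exact: h4.
  (* Another fixed vertex of the same part is held by the owner of that part; without an owner it
     would be held by nobody. *)
  rewrite -E in ow; have oh := h4 x fx dx.
  case: ow => [<- //|[oN _]]; rewrite oN in oh.
  by case: (h2 x (h5 x fx)).
- by move=> x; rewrite /upd_at; case: eqP => [->|_ /h5].
- move=> b t; rewrite {1}/upd_at; case: eqP => [-> [<-]|_ /h6[b1 b2 b3 b4]] //.
  split=> //; have [->//|ts] := eqVneq t s.
  by apply: leq_trans (subset_leq_card (sub t ts)) b4.
- move=> b b' t; rewrite /upd_at.
  case: eqP => [->|_]; case: eqP => [->|_] //.
  + by move=> [<-] hb; case: ow => [ow|[_ no]];
    [apply: h7 ow hb | case: (no b')].
  + by move=> hb [E]; rewrite -E in hb; case: ow => [ow|[_ no]];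
    [apply: h7 hb ow | case: (no b)].
  + exact: h7.
- by move=> t ht; rewrite /upd_at base ?d_c // h8.
- move=> t ht; have [->|ts] := eqVneq t s.
    have := connectedU1 (h9 s hs) (_ : u \in _) uw.
    rewrite !inE hu fu eqxx => /(_ isT); congr induced_connected.
    by apply/setP=> x; rewrite !inE /upd_at; case: (x == w); rewrite ?eqxx.
  have := h9 t ht; congr induced_connected.
  apply/setP=> x; rewrite !inE /upd_at; case: (x =P w) => [->|] //.
  by rewrite (negPf fw) andbF (inj_eq Some_inj) eq_sym (negPf ts).
- move=> x t; rewrite /upd_at; case: eqP => // _ hx fx.
  by have [v [dv hv vx]] := h10 x t hx fx; exists v; rewrite base.
Qed.

Lemma pulling_conn hold fix_ own s :
  pulling hold fix_ own -> home s = j -> induced_connected (class hold s).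
Proof.
move=> [h1 h2 h3 h4 h5 h6 h7 h8 h9 h10] hs.
apply: (connected_pendant _ (h9 s hs)); first exact: subsetIl.
move=> x; rewrite !inE => /eqP hx; rewrite hx eqxx /= => fx.
have [u [du hu ux]] := h10 x s hx fx.
by exists u; rewrite // !inE hu eqxx h3.
Qed.

Lemma pulling_sum hold fix_ own :
  pulling hold fix_ own -> #|region| = \sum_(s in mates) #|class hold s|.
Proof.
move=> [h1 h2 h3 h4 h5 h6 h7 h8 h9 h10]; apply: card_partition.
  move=> x; rewrite inE => /eqP gx; case hx: (hold x) (h2 x gx) => [s|] // _.
  by exists s; rewrite // inE; have [-> _] := h1 _ _ hx.
by move=> x s _ /h1[_ gx]; rewrite inE gx.
Qed.

Lemma pulling_done hold fix_ own :
  pulling hold fix_ own -> (forall u w s, ~ can_pull hold fix_ own u w s) ->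
  forall s, home s = j ->
    N s <= #|class hold s| \/ exists2 b, grp b = j & part b \subset class hold s.
Proof.
move=> hp stuck s hs; have [h1 h2 h3 h4 h5 h6 h7 h8 h9 h10] := hp.
have [//|lt] := leqP (N s) #|class hold s|; [by left | right].
(* A part that is open to s and has no fixed vertex can be entered: by domination it has a neighbour
   of the terminal of s, which is a fixed base vertex. *)
have grab b : grp b = j -> b <> j ->
    own b = Some s \/ own b = None /\ (forall b', own b' <> Some s) ->
    (forall y, y \in part b -> ~~ fix_ y) -> False.
  move=> gb bj ob nofix; have [_ _ dom] := cds_part gb.
  have [|y yb cy] := dom (c s).
    by rewrite inE d_c //; apply/eqP => E; rewrite E in bj.
  apply: (stuck (c s) y s); move: (yb); rewrite inE => /eqP dy.
  split; rewrite ?dy ?h8 //.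
  by split=> //; [apply/h3/d_c | apply: nofix].
have [/existsP[b /eqP ob]|noown] := boolP [exists b, own b == Some s].
  have [bj gb _ _] := h6 b s ob; exists b => //.
  have heldb x : d x = b -> fix_ x -> hold x = Some s.
    by move=> dx fx; rewrite -h4 ?dx.
  (* A part that has been entered but not exhausted has, being connected, an edge from a fixed to an
     unfixed vertex, along which s could pull. *)
  have [/existsP[x /andP[xb fx]]|nofix] := boolP [exists x, (x \in part b) && fix_ x].
    apply/subsetP=> y yb; rewrite inE; apply/eqP.
    have dy : d y = b by move: yb; rewrite inE => /eqP.
    have [fy|fy] := boolP (fix_ y); first exact: heldb.
    have [_ cb _] := cds_part gb.
    have [||u [w [ub uf wb wf uw]]] :=
      @connected_boundary _ _ [set z | fix_ z] x y cb xb _ yb; rewrite ?inE //.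
    move: ub uf wb wf; rewrite !inE => /eqP du fu /eqP dw fw.
    case: (stuck u w s); split=> //; rewrite ?dw ?heldb //; by left.
  exfalso; apply: (grab b gb bj); first by left.
  move=> y yb; apply/negP=> fy; case/negP: nofix; apply/existsP; exists y.
  by rewrite yb.
have no b : own b <> Some s by move=> E; case/negP: noown; apply/existsP;
  exists b; rewrite E.
(* A part without owner has no fixed vertex, so s could enter it. *)
have all_own b : grp b = j -> b <> j -> own b <> None.
  move=> gb bj ob; apply: (grab b gb bj); first by right.
  move=> y; rewrite inE => /eqP dy; apply/negP=> fy.
  have dyj : d y <> j by rewrite dy.
  have := h4 y fy dyj; rewrite dy ob => hy; case: (h2 y _); last by [].
  by rewrite dy.
(* Dropping the base on one side and s on the other leaves equally many parts and terminals.
   Ownership, being injective, is then a bijection, so every terminal other than s is an owner and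
   within its target. *)
pose free := [set b | grp b == j] :\ j.
have cfree : #|free| = #|mates :\ s|.
  have := cardsD1 j [set b | grp b == j]; have := cardsD1 s mates.
  rewrite !inE grp_j hs !eqxx card_mates /free /= !add1n => -> [].
  by [].
pose o b := odflt s (own b).
have oE b : b \in free -> own b = Some (o b).
  rewrite !inE => /andP[/eqP bj /eqP gb]; rewrite /o.
  by case: (own b) (all_own b gb bj).
have oinj : {in free &, injective o}.
  by move=> b b' fb fb' E; apply: (h7 b b' (o b)); rewrite ?oE // E.
have osub : o @: free \subset mates :\ s.
  apply/subsetP=> t /imsetP[b fb ->]; have ob := oE b fb.
  have [_ _ ho _] := h6 _ _ ob; rewrite !inE ho eqxx andbT.
  by apply/eqP=> E; rewrite E in ob; case: (no b).
have oimg : o @: free = mates :\ s.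
  by apply/eqP; rewrite eqEcard osub card_in_imset // cfree leqnn.
have le t : t \in mates -> #|class hold t| <= N t.
  move=> tm; have [->|ts] := eqVneq t s; first exact: ltnW.
  have : t \in o @: free by rewrite oimg in_setD1 ts.
  by move=> /imsetP[b fb ->]; have [] := h6 _ _ (oE b fb).
have : \sum_(t in mates) #|class hold t| < \sum_(t in mates) N t.
  rewrite (bigD1 s) ?inE ?hs //= [X in _ < X](bigD1 s) ?inE ?hs //=.
  rewrite -addSn leq_add // leq_sum // => t /andP[tm _]; exact: le.
by rewrite -(pulling_sum hp) ltnNge size_region.
Qed.

(** [res0] is the answer before the group is treated and stays frozen outside its region. Targets
    enter as upper bounds only; equality will come from exhaustion. *)
Record growing (res0 res : G -> option 'I_k) : Prop := Growing {
  gro_out : forall x, grp (d x) <> j -> res x = res0 x;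
  gro_home : forall x s, grp (d x) = j -> res x = Some s -> home s = j;
  gro_reg : forall x s, home s = j -> res x = Some s -> grp (d x) = j;
  gro_term : forall s, home s = j -> res (c s) = Some s;
  gro_conn : forall s, home s = j -> induced_connected (class res s);
  gro_card : forall s, home s = j -> #|class res s| <= N s }.

Definition can_grow (res : G -> option 'I_k) u w s :=
  [/\ res u = Some s, res w = None, home s = j /\ grp (d w) = j, adj u w
    & #|class res s| < N s].

Lemma growing0 res0 res :
  (forall x, grp (d x) <> j -> res x = res0 x) ->
  (forall x s, home s = j -> res0 x = Some s -> grp (d x) = j) ->
  (forall s, home s = j -> res (c s) = Some s) ->
  (forall x s, grp (d x) = j -> res x = Some s -> home s = j /\ x = c s) ->
  growing res0 res.
Proof.
move=> h1 h2 h3 h4.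
have cl s : home s = j -> class res s = [set c s].
  move=> hs; apply/setP=> x; rewrite !inE; apply/eqP/eqP => [hx|->];
    last exact: h3.
  have [gx|gx] := eqVneq (grp (d x)) j; first by have [] := h4 x s gx hx.
  move/eqP: gx => gx; rewrite h1 // in hx; by case: gx; apply: h2 hx.
split=> //.
- by move=> x s gx hx; have [] := h4 x s gx hx.
- move=> x s hs hx; have : x \in class res s by rewrite inE hx.
  by rewrite cl // inE => /eqP ->; rewrite d_c.
- by move=> s hs; rewrite cl //; apply: connected1.
- by move=> s hs; rewrite cl // cards1.
Qed.

Lemma growing_step res0 res u w s :
  growing res0 res -> can_grow res u w s -> growing res0 (upd_at res w (Some s)).
Proof.
move=> [h1 h2 h3 h4 h5 h6] [hu hw [hs gw] uw lt]; split.
- by move=> x gx; rewrite /upd_at; case: eqP => [E|_];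
  [rewrite E in gx | apply: h1].
- by move=> x t gx; rewrite /upd_at; case: eqP => [_ [<-]|_] //; apply: h2.
- by move=> x t ht; rewrite /upd_at; case: eqP => [->|_] //; apply: h3.
- by move=> t ht; rewrite /upd_at; case: eqP => [E|_];
  [rewrite -E h4 in hw | apply: h4].
- move=> t ht; rewrite class_upd_at ?hw //; case: eqP => [<-|_]; last exact: h5.
  by apply: connectedU1 (h5 s hs) _ uw; rewrite inE hu.
- move=> t ht; rewrite class_upd_at ?hw //; case: eqP => [<-|_]; last exact: h6.
  by rewrite cardsU1 inE hw.
Qed.

(** Growth confined to a connected held class can stop only at the target or when the class is
    filled. No vertex held by s can have gone to another terminal, since every class of the answer
    stays inside the held class of its own terminal. *)
Lemma growing_held res0 res hold :
  growing res0 res -> (forall s, home s = j -> class res s \subset class hold s) ->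
  (forall s, home s = j -> induced_connected (class hold s)) ->
  (forall x s, hold x = Some s -> grp (d x) = j) ->
  (forall u w s, can_grow res u w s -> hold w <> Some s) ->
  forall s, home s = j -> #|class res s| = N s \/ class hold s \subset class res s.
Proof.
move=> [h1 h2 h3 h4 h5 h6] sub conn reg stuck s hs.
have [lt|ge] := ltnP #|class res s| (N s); last first.
  by left; apply/eqP; rewrite eqn_leq ge h6.
right; apply/subsetP=> y yh; apply/negPn/negP => yr.
have cr : c s \in class res s by rewrite inE h4.
have [u [w [_ ur wh wr uw]]] := connected_boundary (conn s hs)
  (subsetP (sub s hs) _ cr) cr yh yr.
move: ur wh wr; rewrite !inE => /eqP ru /eqP hw /eqP rw.
apply: (stuck u w s _ hw); split=> //; last by split=> //; apply: reg hw.
case E: (res w) => [t|//].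
have gw := reg w s hw; have ht := h2 w t gw E.
have : w \in class hold t by apply: (subsetP (sub t ht)); rewrite inE E.
by rewrite inE hw => /eqP[E2]; rewrite E -E2 in rw.
Qed.

(** A short terminal whose class contains a dominating part is adjacent to every unassigned vertex
    of the region. Being stuck, it leaves none, so the classes fill the region although one of them
    is below and none above its target; this contradicts the size of the region. *)
Lemma growing_done res0 res :
  growing res0 res ->
  (forall s, home s = j -> #|class res s| = N s \/
     exists2 b, grp b = j & part b \subset class res s) ->
  (forall u w s, ~ can_grow res u w s) ->
  forall s, home s = j -> #|class res s| = N s.
Proof.
move=> [h1 h2 h3 h4 h5 h6] dom stuck s hs.
have [//|[b gb sb]] := dom s hs; apply/eqP; rewrite eqn_leq h6 //= leqNgt.
apply/negP=> lt; have [_ _ db] := cds_part gb.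
have tot x : grp (d x) = j -> res x <> None.
  move=> gx rx; have [|u ub xu] := db x.
    by apply/negP=> /(subsetP sb); rewrite inE rx.
  move: (subsetP sb u ub); rewrite inE => /eqP ru.
  by apply: (stuck u x s); split; rewrite // adj_sym.
have E : #|region| = \sum_(t in mates) #|class res t|.
  apply: card_partition => [x|x t].
    rewrite inE => /eqP gx; case rx: (res x) (tot x gx) => [t|] // _.
    by exists t; rewrite // inE (h2 x t gx rx).
  by rewrite !inE => /eqP ht /(h3 x t ht) ->.
have : \sum_(t in mates) #|class res t| < \sum_(t in mates) N t.
  rewrite (bigD1 s) ?inE ?hs //= [X in _ < X](bigD1 s) ?inE ?hs //=.
  rewrite -addSn leq_add // leq_sum // => t /andP[].
  by rewrite inE => /eqP ht _; apply: h6.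
by rewrite -E ltnNge size_region.
Qed.

End Group.

Lemma cds_super (S F : {set G}) : cds S -> S \subset F -> cds F.
Proof.
move=> [S0 cS dS] sSF; split.
- by apply: contraNneq S0 => F0; rewrite F0 subset0 in sSF.
- apply: (connected_pendant sSF cS) => x _ xS.
  by have [u uS xu] := dS x xS; exists u; rewrite // adj_sym.
- move=> v vF; have [|u uS vu] := dS v; last by exists u;
  rewrite ?(subsetP sSF).
  by apply: contra vF; apply: subsetP.
Qed.

(** * Counting over all groups and passing to the next one *)

Section Solving.

Variables (c : 'I_k -> G) (N : 'I_k -> nat) (home grp : 'I_k -> 'I_k).

Hypothesis grp_home : forall s, grp (home s) = home s.
Hypothesis home_grp : forall b, exists s, home s = grp b.
Hypothesis sum_N : \sum_s N s = #|G|.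

(* The groups in [sol] have been served for good; the remaining vertices are
   partitioned into connected dominating sets, one for each remaining terminal. *)
Record partial_solution (d : G -> 'I_k) (res : G -> option 'I_k)
    (sol : pred 'I_k) : Prop := PartialSolution {
  par_cds : forall b, ~~ sol (grp b) -> cds (part d b);
  par_term : forall s, ~~ sol (home s) -> d (c s) = home s;
  par_none : forall x, ~~ sol (grp (d x)) -> res x = None;
  par_some : forall x, sol (grp (d x)) -> res x <> None;
  par_home : forall x s, res x = Some s -> home s = grp (d x);
  par_class : forall s, sol (home s) ->
    [/\ #|class res s| = N s, induced_connected (class res s) & res (c s) = Some s] }.

Lemma grp_idem b : grp (grp b) = grp b.
Proof. by have [s <-] := home_grp b. Qed.

Lemma sum_region d : \sum_j #|region grp d j| = #|G|.
Proof.
rewrite -cardsT -[RHS]sum1_card (partition_big (fun x => grp (d x)) xpredT) //=.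
apply: eq_bigr => j _; rewrite -sum1_card; apply: eq_bigl => x.
by rewrite !inE.
Qed.

Lemma sum_mates : \sum_j \sum_(s in mates home j) N s = #|G|.
Proof.
rewrite -sum_N [RHS](partition_big home xpredT) //=.
by apply: eq_bigr => j _; apply: eq_bigl => s; rewrite !inE.
Qed.

Lemma region_solved d res sol j : partial_solution d res sol -> sol j ->
  #|region grp d j| = \sum_(s in mates home j) N s.
Proof.
move=> [h1 h2 h3 h4 h5 h6] sj.
rewrite (@card_partition res _ (mates home j)).
- by apply: eq_bigr => s; rewrite inE => /eqP hs; have [] := h6 s _;
  rewrite ?hs.
- move=> x; rewrite inE => /eqP gx; have := h4 x; rewrite gx => /(_ sj).
  case rx: (res x) => [s|//] _; exists s => //.
  by rewrite inE (h5 _ _ rx) gx.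
- by move=> x s; rewrite !inE => /eqP <- /h5 ->.
Qed.

Lemma region_free d j : grp j <> j -> #|region grp d j| = 0.
Proof.
move=> gj; apply/eqP; rewrite cards_eq0; apply/eqP/setP=> x; rewrite !inE.
by apply/negbTE/eqP => E; case: gj; rewrite -E grp_idem.
Qed.

(** Region sizes and targets both sum to |V|. Served groups balance exactly and an index that heads
    no group has an empty region, so the open groups cannot all be deficient. *)
Lemma surplus_group d res sol j0 :
  partial_solution d res sol -> grp j0 = j0 -> ~~ sol j0 ->
  exists j, [/\ grp j = j, ~~ sol j
    & \sum_(s in mates home j) N s <= #|region grp d j|].
Proof.
move=> ps g0 s0.
have [/existsP[j /and3P[/eqP]]|no] :=
  boolP [exists j, [&& grp j == j, ~~ sol j
    & \sum_(s in mates home j) N s <= #|region grp d j|]]; first by exists j.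
have lt j : grp j = j -> ~~ sol j ->
    #|region grp d j| < \sum_(s in mates home j) N s.
  move=> gj sj; rewrite ltnNge; apply: contra no => le.
  by apply/existsP; exists j; rewrite gj eqxx sj.
have : \sum_j #|region grp d j| < \sum_j \sum_(s in mates home j) N s.
  rewrite (bigD1 j0) //= [X in _ < X](bigD1 j0) //= -addSn leq_add ?lt //.
  apply: leq_sum => j _; have [gj|/eqP gj] := eqVneq (grp j) j.
    have [sj|sj] := boolP (sol j); first by rewrite (region_solved ps sj).
    by apply/ltnW/lt.
  by rewrite region_free.
by rewrite sum_region sum_mates ltnn.
Qed.

(** If j were the last open group, all the others would balance, and a leftover vertex would make
    the regions larger in total than the targets. *)
Lemma leftover_group d res sol j res' x :
  partial_solution d res sol -> grp j = j -> ~~ sol j ->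
  growing c N home grp d j res res' ->
  (forall s, home s = j -> #|class res' s| = N s) ->
  grp (d x) = j -> res' x = None ->
  exists j', [/\ grp j' = j', ~~ sol j' & j' <> j].
Proof.
move=> ps gj sj gr full gx rx.
have [/existsP[j' /and3P[/eqP g' s' /eqP n']]|no] :=
  boolP [exists j', [&& grp j' == j', ~~ sol j' & j' != j]]; first by exists j'.
have E : #|[set y in region grp d j | res' y != None]| = \sum_(s in mates home j) N s.
  rewrite (@card_partition res' _ (mates home j)).
  - by apply: eq_bigr => s; rewrite inE => /eqP; apply: full.
  - move=> y; rewrite !inE; case ry: (res' y) => [s|]; rewrite ?andbF // andbT.
    by move=> /eqP gy; exists s; rewrite // inE (gro_home gr gy ry).
  - by move=> y s; rewrite !inE => /eqP hs ry;
    rewrite ry (gro_reg gr hs ry) eqxx.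
have lt : \sum_(s in mates home j) N s < #|region grp d j|.
  rewrite -E; apply: proper_card; apply/properP; split.
    by apply/subsetP=> y; rewrite !inE => /andP[].
  by exists x; rewrite !inE ?gx ?rx ?eqxx.
have : \sum_j \sum_(s in mates home j) N s < \sum_j #|region grp d j|.
  rewrite (bigD1 j) //= [X in _ < X](bigD1 j) //= -addSn leq_add //.
  apply: leq_sum => i ij; have [gi|/eqP gi] := eqVneq (grp i) i.
    rewrite (region_solved ps) //; apply: contraR no => si.
    by apply/existsP; exists i; rewrite gi eqxx si.
  rewrite (region_free d gi) big1 // => s; rewrite inE => /eqP hs.
  by case: gi; rewrite -hs grp_home.
by rewrite sum_region sum_mates ltnn.
Qed.

(** [P] is the set of leftovers; without them the region of j is exactly the union of its classes.
    The receiving part is quantified after x because, when [P] is empty, there may be no open group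
    to name. *)
Lemma partial_solution_step d res sol j res' d' sol' (P : pred G) :
  partial_solution d res sol -> grp j = j -> ~~ sol j ->
  growing c N home grp d j res res' ->
  (forall s, home s = j -> #|class res' s| = N s) ->
  (forall x, P x = (grp (d x) == j) && (res' x == None)) ->
  (forall x, ~~ P x -> d' x = d x) ->
  (forall b, sol' b = (b == j) || sol b) ->
  (forall x, P x -> exists2 j', [/\ grp j' = j', ~~ sol j' & j' <> j]
     & forall y, P y -> d' y = j') ->
  partial_solution d' res' sol'.
Proof.
move=> [h1 h2 h3 h4 h5 h6] gj sj gr full PE dN solE dP.
have dP' x : P x -> exists2 j', d' x = j' & [/\ grp j' = j', ~~ sol j' & j' <> j].
  by move=> Px; have [j' hj' E] := dP x Px; exists j' => //; apply: E.
have nP x : grp (d x) <> j -> d' x = d x.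
  by move=> gx; apply: dN; rewrite PE; apply/nandP; left; apply/eqP.
have out x : grp (d x) <> j -> res' x = res x := fun gx => gro_out gr gx.
split.
- move=> b; rewrite solE negb_or => /andP[/eqP bj sb].
  apply: cds_super (h1 b sb) _; apply/subsetP=> x; rewrite !inE => /eqP dx.
  by rewrite nP ?dx // => E; rewrite dx in E.
- move=> s; rewrite solE negb_or => /andP[/eqP hj sh].
  by rewrite nP h2 // grp_home.
- move=> x; rewrite solE negb_or; have [Px _|Px] := boolP (P x).
    by move: Px; rewrite PE => /andP[_ /eqP].
  by rewrite dN // => /andP[/eqP gx sx]; rewrite out // h3.
- move=> x; rewrite solE; have [Px|Px] := boolP (P x).
    have [j' -> [g' s' n']] := dP' x Px; rewrite g' (negPf s').
    by move/eqP: n' => /negPf->.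
  rewrite dN //; have [gx _|/eqP gx] := eqVneq (grp (d x)) j.
    by move: Px; rewrite PE gx eqxx /= => /eqP.
  by rewrite out //=; apply: h4.
- move=> x s rx; have Px : ~~ P x by rewrite PE rx andbF.
  rewrite dN //; have [gx|/eqP gx] := eqVneq (grp (d x)) j.
    by rewrite gx; exact: (gro_home gr gx rx).
  by apply: h5; rewrite -out.
- move=> s; rewrite solE; have [hs _|/eqP hs /= sh] := eqVneq (home s) j.
    split; [exact: full | exact: (gro_conn gr hs) | exact: (gro_term gr hs)].
  have E : class res' s = class res s.
    apply/setP=> x; rewrite !inE; have [gx|/eqP gx] := eqVneq (grp (d x)) j.
      have r0 : res x = None by apply: h3; rewrite gx.
      rewrite r0; apply/negbTE/eqP => rx; exact: hs (gro_home gr gx rx).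
    by rewrite out.
  have [r1 r2 r3] := h6 s sh; rewrite E; split=> //.
  by have : c s \in class res' s; [rewrite E inE r3 | rewrite inE => /eqP].
Qed.

End Solving.

End Rules.

(** * Correctness of the program *)

Lemma upd2_eq a t i v b : upd2 a t i v t b = if b == i then v else a t b.
Proof. by rewrite /upd2 eqxx. Qed.

Lemma upd2_ne a t i v u b : u != t -> upd2 a t i v u b = a u b.
Proof. by rewrite /upd2 => /negPf->. Qed.

Lemma bool_neq0 (b : bool) : ((b : nat) != 0) = b.
Proof. by case: b. Qed.

Lemma bool_add_neq0 (b b' : bool) : ((b : nat) + b' != 0) = b || b'.
Proof. by case: b b' => [] []. Qed.

Lemma run_for n L (I : nat -> store -> Prop) x c s :
  I 0 s -> (forall i s, i < n -> I i s -> I i.+1 (run n L c (setv s x i))) ->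
  I n (run n L (For x c) s).
Proof.
move=> I0 IS /=; have key m : m <= n -> I m
    (iteri m (fun i s => run n L c (setv s x i)) s).
  by elim: m => //= m IH hm; apply: IS => //; apply: IH; apply: ltnW.
exact: key.
Qed.

(** * Representation of the objects in arrays *)

Section Refinement.

Variables (G : graph) (k : nat) (c : 'I_k -> G) (N : 'I_k -> nat).
Hypothesis c_inj : injective c.
Hypothesis N_gt0 : forall s, 0 < N s.
Variables (d0 : G -> 'I_k) (inp : nat -> nat).

Let n := #|G|.
Let L := 2 + (n * n + (k + (k + k * n))).

Definition rk (x : G) : nat := enum_rank x.

Lemma rk_lt x : rk x < n.
Proof. exact: ltn_ord. Qed.

Lemma rk_inj : injective rk.
Proof. by move=> x y /val_inj/enum_rank_inj. Qed.

Lemma rk_eq x y : (rk x == rk y) = (x == y).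
Proof. exact: inj_eq rk_inj _ _. Qed.

Lemma rk_surj i : i < n -> exists x, i = rk x.
Proof.
by move=> hi; exists (enum_val (Ordinal hi)); rewrite /rk enum_valK.
Qed.

Lemma k_le_n : k <= n.
Proof. by rewrite -[k]card_ord; apply: leq_card c_inj. Qed.

Definition code (o : option 'I_k) : nat := if o is Some s then s.+1 else 0.

Lemma code_inj : injective code.
Proof. by move=> [s|] [t|] //= [/ord_inj->]. Qed.

Lemma code_eq0 o : (code o == 0) = (o == None).
Proof. by case: o. Qed.

Hypothesis inp0 : inp 0 = n.
Hypothesis inp1 : inp 1 = k.
Hypothesis inp_adj : forall x y, inp (2 + (rk x * n + rk y)) = adj x y.
Hypothesis inp_term : forall s : 'I_k, inp (2 + (n * n + s)) = rk (c s).
Hypothesis inp_size : forall s : 'I_k, inp (2 + (n * n + (k + s))) = N s.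
Hypothesis inp_dom : forall (s : 'I_k) x,
  inp (2 + (n * n + (k + (k + (s * n + rk x))))) = (d0 x == s).

Definition ctx (j : nat) (s : store) : Prop :=
  [/\ va s vK = k, va s vJ = j & lo s = inp].

Lemma ctx_ignores j x : x != vK -> x != vJ -> ignores (ctx j) x.
Proof.
by move=> h1 h2 s v [e1 e2 e3]; split;
  rewrite /= ?/upd // eq_sym ?(negPf h1) ?(negPf h2).
Qed.

Lemma ctx_flat j s a : ctx j s -> a < L -> flat L s a = inp a.
Proof. by move=> [_ _ e] h; rewrite /flat h e. Qed.

Lemma adj_addr u w : u < n -> w < n -> 2 + (u * n + w) < L.
Proof. by rewrite /L; nia. Qed.

Section Static.

Variables home grp : 'I_k -> 'I_k.

Record static (d : G -> 'I_k) (a : nat -> nat -> nat) : Prop := Static {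
  st_mul : forall u, u <= n -> a MUL u = u * n;
  st_dom : forall x, a DOM (rk x) = d x;
  st_sz : forall s : 'I_k, a SZ s.+1 = N s;
  st_home : forall s : 'I_k, a HOME s.+1 = home s;
  st_term : forall s : 'I_k, a TERM s.+1 = rk (c s);
  st_grp : forall b : 'I_k, a GRP b = grp b }.

(** Frame conditions go by array number: 0 to 5 describe the instance and its grouping, 6 and 7
    belong to the matching, 8 and 9 carry results from group to group, and 10 to 15 are scratch for
    the current group. *)
Definition agree (T : pred nat) (a a' : nat -> nat -> nat) : Prop :=
  forall t i, T t -> a' t i = a t i.

Lemma agreeW (T T' : pred nat) a a' : subpred T' T -> agree T a a' -> agree T' a a'.
Proof. by move=> h ag t i /h/ag. Qed.

Lemma agree_trans (T : pred nat) a a' a'' :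
  agree T a a' -> agree T a' a'' -> agree T a a''.
Proof. by move=> h1 h2 t i ht; rewrite h2 // h1. Qed.

Lemma agree_upd2 (T : pred nat) a a' t i v :
  ~~ T t -> agree T a a' -> agree T a (upd2 a' t i v).
Proof.
move=> nt h u b hu; rewrite upd2_ne ?h //; apply: contraNneq nt => <-.
by [].
Qed.

Lemma static_agree d a a' :
  agree (fun t => t < 6) a a' -> static d a -> static d a'.
Proof.
move=> h [h1 h2 h3 h4 h5 h6].
by split=> *; rewrite h ?h1 ?h2 ?h3 ?h4 ?h5 ?h6.
Qed.

Lemma edgeE j d s u w : ctx j s -> static d (ar s) -> va s vU = rk u ->
  va s vW = rk w -> ev L edge s = adj u w.
Proof.
move=> cs st eu ew; rewrite /= (st_mul st) ?eu ?ew; last exact: ltnW (rk_lt _).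
by rewrite (ctx_flat cs) ?inp_adj // adj_addr ?rk_lt.
Qed.

Section Group.

Variables (d : G -> 'I_k) (j : 'I_k) (res0 : G -> option 'I_k).
Hypothesis grp_j : grp j = j.
Hypothesis mates_neq0 : exists s, home s = j.
Hypothesis card_mates : #|[set b | grp b == j]| = #|mates home j|.
Hypothesis cds_part : forall b, grp b = j -> cds (part d b).
Hypothesis d_c : forall s, home s = j -> d (c s) = j.
Hypothesis size_region : \sum_(s in mates home j) N s <= #|region grp d j|.
Hypothesis res0_region : forall x, grp (d x) = j -> res0 x = None.
Hypothesis res0_home : forall x s, res0 x = Some s -> home s <> j.

Section Frame.

Variable a0 : nat -> nat -> nat.
Hypothesis st0 : static d a0.

Lemma static_same (T : pred nat) a :
  (forall t, t < 6 -> T t) -> agree T a0 a -> static d a.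
Proof. by move=> h ag; apply: static_agree st0; apply: agreeW ag. Qed.

Definition same_colour (t : nat) : bool := (t < 10) || (12 < t).

Definition inv_colour (a : nat -> nat -> nat) : Prop :=
  exists2 hold, colouring c home grp d j hold &
  [/\ forall x, a HOLD (rk x) = code (hold x),
      forall x, a FIX (rk x) = (hold x != None) && (d x == j),
      forall s : 'I_k, home s = j -> a CNT s.+1 = #|class hold s|
    & agree same_colour a0 a].

(** The measure of all three processes: colouring marks a vertex in [HOLD], pulling in [FIX],
    growing in [RES], and none of them erases a mark of its own array. *)
Definition held (t : nat) (a : nat -> nat -> nat) : nat :=
  #|[set x | a t (rk x) != 0]|.

Lemma held_le t a : held t a <= n.
Proof. exact: max_card. Qed.

Lemma held_lt t a a' w :
  (forall x, a t (rk x) != 0 -> a' t (rk x) != 0) ->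
  a t (rk w) == 0 -> a' t (rk w) != 0 -> held t a < held t a'.
Proof.
move=> sub h0 h1; apply: proper_card; apply/properP; split.
  by apply/subsetP=> x; rewrite !inE; apply: sub.
by exists w; rewrite !inE ?h0.
Qed.

Definition G_colour (a : nat -> nat -> nat) (u w : nat) : bool :=
  [&& a FIX u != 0, a HOLD w == 0, a GRP (a DOM w) == j
    & inp (2 + (u * n + w)) != 0].

Lemma class_move (hold : G -> option 'I_k) w s t :
  class (upd_at hold w (Some s)) t =
  if t == s then w |: class hold t else class hold t :\ w.
Proof.
apply/setP=> x; rewrite /class /upd_at; case: (eqVneq t s) => [->|ts];
  rewrite !inE.
  by case: (x == w); rewrite ?eqxx.
by case: (x == w) => //=; rewrite (inj_eq Some_inj) eq_sym (negPf ts).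
Qed.

Lemma run_colour s : ctx j s -> inv_colour (ar s) ->
  let s' := run n L (sat2 vP vU vW g_colour c_colour) s in
  ctx j s' /\ exists2 hold, colouring c home grp d j hold
      /\ (forall x, grp (d x) = j -> hold x <> None) &
    [/\ forall x, ar s' HOLD (rk x) = code (hold x),
        forall x, ar s' FIX (rk x) = (hold x != None) && (d x == j),
        forall s : 'I_k, home s = j -> ar s' CNT s.+1 = #|class hold s|
      & agree same_colour a0 (ar s')].
Proof.
move=> cs Is /=.
have [|||||||||c1 I1 stuck] := @sat2P n L inv_colour (held HOLD) _ (ctx j) vP vU vW
  g_colour c_colour G_colour s; rewrite ?ctx_ignores //.
- by move=> a _; apply: held_le.
- move=> s1 c1 [hold _ [_ _ _ ag]] hu hw.
  have [u eu] := rk_surj hu; have [w ew] := rk_surj hw.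
  have st1 : static d (ar s1) by apply: static_same ag => t;
    rewrite /same_colour; lia.
  have eE := edgeE c1 st1 eu ew; rewrite /= in eE.
  rewrite /= eE !bool_neq0 /G_colour eu ew inp_adj bool_neq0.
  by have [_ -> _] := c1.
- move=> s1 c1 [hold ci [l1 l2 l3 ag]] hu hw.
  have [u eu] := rk_surj hu; have [w ew] := rk_surj hw.
  have st1 : static d (ar s1) by apply: static_same ag => t;
    rewrite /same_colour; lia.
  rewrite /G_colour eu ew inp_adj l1 l2 !bool_neq0 code_eq0 (st_dom st1) (st_grp st1).
  case hu' : (hold u) => [q|//] /and4P[/= /eqP du /eqP hw' /eqP/ord_inj gw uw].
  have uw' : (rk u == rk w) = false by rewrite rk_eq; apply/eqP => E;
    rewrite E hw' in hu'.
  have [hq _] := col_home ci hu'.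
  have ci' := colouring_step ci du hu' hw' gw uw.
  rewrite /= eu ew; split=> //.
  + exists (upd_at hold w (Some q)) => //; split.
    * by move=> x; rewrite !(upd2_eq, upd2_ne) // rk_eq /upd_at; case: ifP;
      rewrite ?l1 ?hu'.
    * move=> x; rewrite !(upd2_eq, upd2_ne) // rk_eq /upd_at;
      case: eqP => [->|_]; last exact: l2.
      by rewrite (st_dom st1); have [_ -> _] := c1.
    * move=> t ht;
      rewrite !(upd2_eq, upd2_ne) // uw' l1 hu' /= eqSS class_upd_at ?hw' //.
      rewrite eq_sym -val_eqE; case: eqP => [E|_]; last exact: l3.
      have -> : t = q by apply: val_inj.
      by rewrite l3 // cardsU1 inE hw' addnC.
    * by do !apply: agree_upd2.
  + apply: (held_lt (w := w)); rewrite ?l1 ?hw' //.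
      by move=> x; rewrite !(upd2_eq, upd2_ne) //; case: ifP; rewrite ?l1 ?hu'.
    by rewrite !(upd2_eq, upd2_ne) // eqxx ?l1 hu'.
split=> //; have [hold ci [l1 l2 l3 ag]] := I1; exists hold => //; split=> //.
have st1 : static d (ar (run n L (sat2 vP vU vW g_colour c_colour) s)).
  by apply: static_same ag => t; rewrite /same_colour; lia.
apply: (colouring_total grp_j mates_neq0 cds_part d_c ci) => // u w q du hu hw gw uw.
have /negP := stuck (rk u) (rk w) (rk_lt u) (rk_lt w); apply.
by rewrite /G_colour l1 l2 hu hw du inp_adj uw (st_dom st1) ?(st_grp st1) ?gw ?eqxx.
Qed.

Definition same_pull (t : nat) : bool := (t < 10) || (t == FC).

(** [HAS] caches whether a terminal occurs in [OWN], so that the guard needs no search. *)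
Definition inv_pull (a : nat -> nat -> nat) : Prop :=
  exists hold (fix_ : pred G) own, pulling c N home grp d j hold fix_ own /\
  [/\ forall x, a HOLD (rk x) = code (hold x),
      forall x, (a FIX (rk x) != 0) = fix_ x,
      forall s : 'I_k, home s = j -> a CNT s.+1 = #|class hold s|,
      forall b : 'I_k, a OWN b = code (own b)
    & (forall s : 'I_k, (a HAS s.+1 != 0) = [exists b, own b == Some s]) /\
      agree same_pull a0 a].

Definition G_pull (a : nat -> nat -> nat) (u w : nat) : bool :=
  [&& a FIX u != 0, a FIX w == 0, a GRP (a DOM w) == j,
      inp (2 + (u * n + w)) != 0, a CNT (a HOLD u) < a SZ (a HOLD u)
    & (a OWN (a DOM w) == a HOLD u)
      || ((a OWN (a DOM w) == 0) && (a HAS (a HOLD u) == 0))].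

Lemma code_eqS o (s : 'I_k) : (code o == s.+1) = (o == Some s).
Proof. exact: (inj_eq code_inj o (Some s)). Qed.

Lemma run_pull s : ctx j s -> inv_pull (ar s) ->
  let s' := run n L (sat2 vP vU vW g_pull c_pull) s in
  [/\ ctx j s', agree same_pull a0 (ar s') & exists hold,
    [/\ forall x, ar s' HOLD (rk x) = code (hold x),
      forall x s, hold x = Some s -> home s = j /\ grp (d x) = j,
      forall s, home s = j -> hold (c s) = Some s,
      forall s, home s = j -> induced_connected (class hold s)
    & forall s, home s = j -> N s <= #|class hold s| \/
        exists2 b, grp b = j & part d b \subset class hold s]].
Proof.
move=> cs Is /=.
have [|||||||||c1 I1 stuck] := @sat2P n L inv_pull (held FIX) _ (ctx j) vP vU vW
  g_pull c_pull G_pull s; rewrite ?ctx_ignores //.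
- by move=> a _; apply: held_le.
- move=> s1 c1 [hold [fix_ [own [_ [_ _ _ _ [_ ag]]]]]] hu hw.
  have [u eu] := rk_surj hu; have [w ew] := rk_surj hw.
  have st1 : static d (ar s1) by apply: static_same ag => t;
    rewrite /same_pull; lia.
  have eE := edgeE c1 st1 eu ew; rewrite /= in eE.
  rewrite /= eE !(bool_neq0, bool_add_neq0) /G_pull eu ew inp_adj bool_neq0.
  by have [_ -> _] := c1.
- move=> s1 c1 [hold [fix_ [own [pi [l1 l2 l3 l4 [l5 ag]]]]]] hu hw.
  have [u eu] := rk_surj hu; have [w ew] := rk_surj hw.
  have st1 : static d (ar s1) by apply: static_same ag => t;
    rewrite /same_pull; lia.
  rewrite /G_pull eu ew inp_adj l1 l2 !bool_neq0 (st_dom st1) (st_grp st1) l4.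
  case/and5P=> fu; rewrite -[_ == 0]negbK l2 => fw /eqP/ord_inj gw uw.
  have gu : grp (d u) = j := pul_fix pi fu.
  case hu' : (hold u) (pul_total pi gu) => [q|//] _.
  have [hq _] := pul_home pi hu'.
  case hw' : (hold w) (pul_total pi gw) => [p|//] _.
  have [hp _] := pul_home pi hw'.
  rewrite (l3 q hq) (st_sz st1) /= code_eqS code_eq0 -[_ == 0]negbK l5.
  case/andP=> lt ow.
  have cp : can_pull N grp d j hold fix_ own u w q.
    split=> //; case/orP: ow => [/eqP|/andP[/eqP ow no]]; [by left | right].
    split=> // b E; case/negP: no; apply/existsP; exists b; exact/eqP.
  have pi' := pulling_step d_c pi cp.
  have uw' : (rk u == rk w) = false.
    by rewrite rk_eq; apply/eqP => E; rewrite E (negPf fw) in fu.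
  rewrite /= eu ew; split=> //.
  + exists (upd_at hold w (Some q)), (upd_at fix_ w true), (upd_at own (d w) (Some q)).
    split=> //; split.
    * by move=> x; rewrite !(upd2_eq, upd2_ne) // rk_eq /upd_at; case: ifP;
      rewrite ?l1 ?hu'.
    * by move=> x; rewrite !(upd2_eq, upd2_ne) // rk_eq /upd_at; case: ifP;
      rewrite ?l2.
    * move=> t ht; rewrite !(upd2_eq, upd2_ne) // !l1 hu' hw' /= !eqSS !val_eqE.
      rewrite class_move; have wc : w \in class hold p by rewrite inE hw'.
      have := cardsD1 w (class hold p); rewrite wc add1n => E.
      (* The previous holder p may be the puller q itself; the class and its count are then
         unchanged. *)
      case: (eqVneq t q) => [->|tq].
        case: (eqVneq q p) => [->|qp].
          by rewrite l3 // cardsU1 wc add0n E subn1 addn1.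
        by rewrite l3 // cardsU1 !inE hw' (inj_eq Some_inj) eq_sym (negPf qp) addnC.
      case: (eqVneq t p) => [->|tp]; first by rewrite l3 // E subn1.
      rewrite l3 //; congr #|pred_of_set _|; apply/setP=> x; rewrite !inE.
      by case: (x =P w) => [->|] //;
        rewrite hw' (inj_eq Some_inj) eq_sym (negPf tp).
    * move=> b; rewrite !(upd2_eq, upd2_ne) // (st_dom st1) val_eqE /upd_at.
      by case: ifP; rewrite ?l1 ?hu'.
    * split; last by do !apply: agree_upd2.
      move=> t; rewrite !(upd2_eq, upd2_ne) // l1 hu' /= eqSS val_eqE.
      case: (eqVneq t q) => [->|tq].
        by apply/esym/existsP; exists (d w); rewrite /upd_at eqxx.
      rewrite l5; apply/existsP/existsP => -[b]; rewrite /upd_at.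
        move=> ob; exists b; case: (b =P d w) => // E; rewrite E in ob.
        case/orP: ow => [|/andP[oN _]]; last by rewrite (eqP oN) in ob.
        by rewrite (eqP ob) (inj_eq Some_inj) (negPf tq).
      case: (b =P d w) => [_|_ ob]; last by exists b.
      by rewrite (inj_eq Some_inj) eq_sym (negPf tq).
  + apply: (held_lt (w := w)).
    * by move=> x; rewrite !(upd2_eq, upd2_ne) //; case: ifP.
    * by rewrite -[_ == 0]negbK l2.
    * by rewrite !(upd2_eq, upd2_ne) // eqxx.
have [hold [fix_ [own [pi [l1 l2 l3 l4 [l5 ag]]]]]] := I1.
have st1 : static d (ar (run n L (sat2 vP vU vW g_pull c_pull) s)).
  by apply: static_same ag => t; rewrite /same_pull; lia.
split=> //; exists hold; split=> //.
- by move=> x t hx; apply: (pul_home pi hx).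
- by move=> t ht; apply: (pul_term pi ht).
- by move=> t ht; apply: (pulling_conn pi ht).
apply: (pulling_done grp_j card_mates cds_part d_c size_region pi).
move=> u w q [[fu fw gw] hu uw lt ow].
have [hq _] := pul_home pi hu.
have /negP := stuck (rk u) (rk w) (rk_lt u) (rk_lt w); apply.
rewrite /G_pull l1 l2 fu -[_ == 0]negbK l2 fw hu inp_adj uw (st_dom st1) (st_grp st1).
rewrite gw eqxx /= (l3 q hq) (st_sz st1) lt l4 code_eqS code_eq0.
case: ow => [->|[-> no]]; first by rewrite eqxx.
rewrite -[_ == 0]negbK l5; apply/orP; right; rewrite eqxx /=.
by apply/existsP => -[b /eqP/no].
Qed.

End Frame.

Section Grow.

Variables (P : (G -> option 'I_k) -> Prop) (X : G -> 'I_k -> bool).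
Variables (Xa : (nat -> nat -> nat) -> nat -> nat -> bool) (ge : exp).
Variable a1 : nat -> nat -> nat.

Definition same_grow (t : nat) : bool := (t < 9) || (9 < t < 15).

Hypothesis st1 : static d a1.
Hypothesis geE : forall s, (ev L ge s != 0) =
  (ev L g_grow s != 0) && Xa (ar s) (va s vU) (va s vW).
Hypothesis XaE : forall a u w (q : 'I_k),
  agree same_grow a1 a -> a RES (rk u) = q.+1 -> Xa a (rk u) (rk w) = X w q.
Hypothesis P_step : forall res u w q, P res -> can_grow N home grp d j res u w q ->
  X w q -> P (upd_at res w (Some q)).

Definition inv_grow (a : nat -> nat -> nat) : Prop :=
  exists2 res, growing c N home grp d j res0 res /\ P res &
  [/\ forall x, a RES (rk x) = code (res x),
      forall s : 'I_k, home s = j -> a FC s.+1 = #|class res s|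
    & agree same_grow a1 a].

Definition G_grow (a : nat -> nat -> nat) (u w : nat) : bool :=
  [&& a RES u != 0, a RES w == 0, a GRP (a DOM w) == j, a HOME (a RES u) == j,
      inp (2 + (u * n + w)) != 0 & a FC (a RES u) < a SZ (a RES u)]
  && Xa a u w.

(** The loop is used twice, once confined to the held classes and once freely; [X] is the additional
    restriction, [Xa] its reading in the arrays, and [P] an invariant particular to each use. *)
Lemma run_grow s : ctx j s -> inv_grow (ar s) ->
  let s' := run n L (sat2 vP vU vW ge c_grow) s in
  [/\ ctx j s', agree same_grow a1 (ar s') & exists2 res,
    [/\ growing c N home grp d j res0 res, P res &
      forall u w q, can_grow N home grp d j res u w q -> ~~ X w q] &
    (forall x, ar s' RES (rk x) = code (res x)) /\
    (forall s : 'I_k, home s = j -> ar s' FC s.+1 = #|class res s|)].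
Proof.
move=> cs Is /=.
have stat a : agree same_grow a1 a -> static d a.
  by move=> ag; apply: static_agree st1; apply: agreeW ag => t;
    rewrite /same_grow; lia.
have [|||||||||c1 I1 stuck] := @sat2P n L inv_grow (held RES) _ (ctx j) vP vU vW
  ge c_grow G_grow s; rewrite ?ctx_ignores //.
- by move=> a _; apply: held_le.
- move=> s1 c1 [res _ [_ _ ag]] hu hw.
  have [u eu] := rk_surj hu; have [w ew] := rk_surj hw.
  have st2 := stat _ ag.
  have eE := edgeE c1 st2 eu ew; rewrite /= in eE.
  rewrite geE /= eE !bool_neq0 /G_grow eu ew inp_adj bool_neq0.
  by have [_ -> _] := c1.
- move=> s1 c1 [res [gr Pr] [l1 l2 ag]] hu hw.
  have [u eu] := rk_surj hu; have [w ew] := rk_surj hw.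
  have st2 := stat _ ag.
  rewrite /G_grow eu ew inp_adj !l1 !bool_neq0 code_eq0 (st_dom st2) (st_grp st2).
  case hu' : (res u) => [q|//].
  rewrite /= (st_home st2) (st_sz st2) (@XaE _ u w q ag) ?l1 ?hu' //.
  rewrite code_eq0.
  case/andP=> /and5P[/eqP hw' /eqP/ord_inj gw /eqP/ord_inj hq uw].
  rewrite l2 // => lt xw.
  have cg : can_grow N home grp d j res u w q by split.
  have gr' := growing_step gr cg.
  have uw' : (rk u == rk w) = false by rewrite rk_eq; apply/eqP => E;
    rewrite E hw' in hu'.
  rewrite /= eu ew; split=> //.
  + exists (upd_at res w (Some q)); first by split=> //; apply: P_step cg xw.
    split.
    * by move=> x; rewrite !(upd2_eq, upd2_ne) // rk_eq /upd_at; case: ifP;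
      rewrite ?l1 ?hu'.
    * move=> t ht;
      rewrite !(upd2_eq, upd2_ne) // l1 hu' /= eqSS class_upd_at ?hw' //.
      rewrite eq_sym val_eqE; case: eqP => [<-|_]; last exact: l2.
      by rewrite l2 // cardsU1 inE hw' addnC.
    * by do !apply: agree_upd2.
  + apply: (held_lt (w := w)); rewrite ?l1 ?hw' //.
      by move=> x; rewrite !(upd2_eq, upd2_ne) //; case: ifP; rewrite ?l1 ?hu'.
    by rewrite !(upd2_eq, upd2_ne) // eqxx ?l1 hu'.
have [res [gr Pr] [l1 l2 ag]] := I1; have st2 := stat _ ag.
split=> //; exists res => //; split=> // u w q [hu hw [hq gw] uw lt].
apply/negP=> xw.
have /negP := stuck (rk u) (rk w) (rk_lt u) (rk_lt w); apply.
rewrite /G_grow !l1 hu hw (st_dom st2) (st_grp st2) gw (st_home st2) hq inp_adj uw.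
by rewrite (l2 q hq) (st_sz st2) lt !eqxx (@XaE _ u w q ag) ?l1 ?hu.
Qed.

End Grow.

(** * Complete treatment of one group *)

Definition seed (x : G) : option 'I_k := [pick s | (home s == j) && (c s == x)].

Lemma seedP x s : seed x = Some s <-> home s = j /\ x = c s.
Proof.
rewrite /seed; case: pickP => [t /andP[/eqP ht /eqP <-]|no].
  by split=> [[<-]|[hs /c_inj->]].
by split=> // -[hs E]; have := no s; rewrite hs E !eqxx.
Qed.

Lemma run_clear s : ctx j s ->
  let s' := run n L p_clear s in
  [/\ ctx j s', agree (fun t => t < 10) (ar s) (ar s')
    & forall i, i < n -> [/\ ar s' HOLD i = 0, ar s' FIX i = 0, ar s' OWN i = 0
                           & ar s' HAS i.+1 = 0]].
Proof.
move=> cs; pose I m s' := [/\ ctx j s', agree (fun t => t < 10) (ar s) (ar s')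
    & forall i, i < m -> [/\ ar s' HOLD i = 0, ar s' FIX i = 0, ar s' OWN i = 0
                           & ar s' HAS i.+1 = 0]].
apply: (run_for (I := I)) => [|m s1 hm [c1 ag h]]; first by split.
have c2 : ctx j (setv s1 vU m) by apply: ctx_ignores.
rewrite /= /upd !eqxx; split; [by case: c2 | by do !apply: agree_upd2 | ].
move=> i; rewrite ltnS leq_eqVlt => him.
rewrite /= !(upd2_eq, upd2_ne) // addn1 eqSS; case: eqP him => //= _ /h[].
by [].
Qed.

Lemma run_seed s : ctx j s -> static d (ar s) ->
  (forall x, ar s RES (rk x) = code (res0 x)) ->
  (forall x, ar s HOLD (rk x) = 0 /\ ar s FIX (rk x) = 0) ->
  let s' := run n L p_seed s in
  [/\ ctx j s', agree (fun t => (t < 9) || (t == OWN) || (t == HAS)) (ar s) (ar s')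
    & [/\ forall x, ar s' HOLD (rk x) = code (seed x),
        forall x, ar s' FIX (rk x) = (seed x != None),
        forall s : 'I_k, home s = j -> ar s' CNT s.+1 = 1 /\ ar s' FC s.+1 = 1
      & forall x, ar s' RES (rk x) =
          code (if seed x is Some s then Some s else res0 x)]].
Proof.
move=> cs st hr h0.
pose I m s' := [/\ ctx j s',
  agree (fun t => (t < 9) || (t == OWN) || (t == HAS)) (ar s) (ar s'),
  forall t : 'I_k, t < m -> home t = j ->
    [/\ ar s' HOLD (rk (c t)) = t.+1, ar s' FIX (rk (c t)) = 1,
        ar s' RES (rk (c t)) = t.+1 & ar s' CNT t.+1 = 1 /\ ar s' FC t.+1 = 1]
  & forall x, (forall t : 'I_k, t < m -> home t = j -> x <> c t) ->
    [/\ ar s' HOLD (rk x) = 0, ar s' FIX (rk x) = 0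
      & ar s' RES (rk x) = code (res0 x)]].
have [c1 ag h1 h2] : I n (run n L p_seed s).
  apply: run_for => [|m s1 hm [c1 ag h1 h2]].
    by split=> // x _; have [-> ->] := h0 x.
  have st1 : static d (ar s1).
    by apply: static_agree st; apply: agreeW ag => t; lia.
  have c2 : ctx j (setv s1 vU m) by apply: ctx_ignores.
  have [e1 e2 _] := c1.
  rewrite /= /upd /= !addn1 e1 e2 !bool_neq0.
  have skip : (forall t : 'I_k, t = m :> nat -> home t <> j) -> I m.+1 (setv s1 vU m).
    move=> no; split=> //= [t|x hx].
      by rewrite ltnS leq_eqVlt => /orP[/eqP/no//|]; apply: h1.
    by apply: h2 => t lt; apply: hx; apply: ltnW.
  have [mk|mk] := ltnP m k; last first.
    by apply: skip => t E; have := ltn_ord t; rewrite E ltnNge mk.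
  have hom := st_home st1 (Ordinal mk); rewrite /= in hom; rewrite hom.
  have term := st_term st1 (Ordinal mk); rewrite /= in term; rewrite term.
  case: eqP => [/ord_inj hj|ne]; last first.
    by apply: skip => t E; apply: contra_not ne => <-; congr (home _ : nat);
      apply: val_inj.
  rewrite /= !(upd2_eq, upd2_ne) // term.
  split=> /=.
  + by have [? ? ?] := c2; split.
  + by do !apply: agree_upd2.
  + move=> t; rewrite ltnS leq_eqVlt => /orP[/eqP E|tm] ht.
      have -> : Ordinal mk = t by apply: val_inj; rewrite /= E.
      by rewrite !(upd2_eq, upd2_ne) // E !eqxx.
    have [r1 r2 r3 [r4 r5]] := h1 t tm ht.
    have ne : (rk (c t) == rk (c (Ordinal mk))) = false.
      by rewrite rk_eq (inj_eq c_inj) -val_eqE /= ltn_eqF.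
    by rewrite !(upd2_eq, upd2_ne) // ne eqSS (ltn_eqF tm).
  + move=> x hx; have [|r1 r2 r3] := h2 x.
      by move=> t tm; apply: hx; apply: ltnW.
    have ne : (rk x == rk (c (Ordinal mk))) = false.
      by rewrite rk_eq; apply/eqP; apply: hx.
    by rewrite !(upd2_eq, upd2_ne) // ne.
have seedE x : [/\ ar (run n L p_seed s) HOLD (rk x) = code (seed x),
    ar (run n L p_seed s) FIX (rk x) = (seed x != None)
  & ar (run n L p_seed s) RES (rk x) =
      code (if seed x is Some s then Some s else res0 x)].
  case E: (seed x) => [t|].
    by have [ht ->] := (seedP x t).1 E;
      have [-> -> -> _] := h1 t (leq_trans (ltn_ord t) k_le_n) ht.
  have [|-> -> ->] := h2 x; last by [].
  move=> t _ ht Ex; have := (seedP x t).2 (conj ht Ex).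
  by rewrite E.
split=> //; split.
- by move=> x; have [] := seedE x.
- by move=> x; have [] := seedE x.
- by move=> t ht; have [_ _ _ []] := h1 t (leq_trans (ltn_ord t) k_le_n) ht.
- by move=> x; have [] := seedE x.
Qed.

Lemma run_group s : ctx j s -> static d (ar s) ->
  (forall x, ar s RES (rk x) = code (res0 x)) ->
  let s' := run n L p_group s in
  [/\ ctx j s', agree (fun t => t < 9) (ar s) (ar s') & exists res,
    [/\ growing c N home grp d j res0 res,
        forall x, ar s' RES (rk x) = code (res x)
      & forall t, home t = j -> #|class res t| = N t]].
Proof.
move=> cs st hr; rewrite /p_group /=.
have := run_clear cs; set s1 := run n L p_clear s => -[c1 ag1 z1].
have st1 : static d (ar s1).
  by apply: static_agree st; apply: agreeW ag1 => t; lia.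
have := run_seed (s := s1) c1 st1 _ _; set s2 := run n L p_seed s1.
case=> [x|x|c2 ag2 [hd2 fx2 cf2 rs2]].
- by rewrite ag1.
- by have [] := z1 _ (rk_lt x).
have st2 : static d (ar s2).
  by apply: static_agree st1; apply: agreeW ag2 => t; lia.
have seed_c t : home t = j -> seed (c t) = Some t by move=> ht; apply/seedP.
have cl t : home t = j -> class seed t = [set c t].
  move=> ht; apply/setP=> x; rewrite !inE; apply/eqP/eqP => [/seedP[]//|->].
  exact: seed_c.
have z2 (b : 'I_k) : ar s2 OWN b = 0 /\ ar s2 HAS b.+1 = 0.
  by rewrite !ag2 //; have [] := z1 b (leq_trans (ltn_ord b) k_le_n).
have I2 : inv_colour (ar s2) (ar s2).
  exists seed.
    by apply: colouring0 => // x t /seedP.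
  split=> //.
  - move=> x; rewrite fx2; case E: (seed x) => [t|//];
    have [ht ->] := (seedP x t).1 E.
    by rewrite d_c // eqxx.
  - by move=> t ht; rewrite cl // cards1; have [] := cf2 t ht.
have := run_colour st2 c2 I2; set s3 := run n L (sat2 _ _ _ g_colour _) s2.
case=> c3 [hold [ci tot] [hd3 fx3 cn3 ag3]].
have st3 : static d (ar s3).
  by apply: static_same ag3 => // t; rewrite /same_colour; lia.
have I3 : inv_pull (ar s3) (ar s3).
  exists hold, (mem (part d j)), (fun=> None); split;
    first exact: (pulling0 _ grp_j).
  split=> //.
  - move=> x; rewrite fx3 bool_neq0 /= inE andb_idl // => /eqP dx.
    by apply/eqP/tot; rewrite dx.
  - by move=> b; rewrite ag3 //; have [] := z2 b.
  split=> // t; rewrite ag3 //; have [_ ->] := z2 t.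
  by apply/esym/existsP => -[b].
have := run_pull st3 c3 I3; set s4 := run n L (sat2 _ _ _ g_pull _) s3.
case=> c4 ag4 [hl [hd4 hh4 ht4 cn4 en4]].
have st4 : static d (ar s4).
  by apply: static_same ag4 => // t; rewrite /same_pull; lia.
pose res1 x := if seed x is Some s then Some s else res0 x.
have rs4 x : ar s4 RES (rk x) = code (res1 x) by rewrite ag4 // ag3 // rs2.
have gr1 : growing c N home grp d j res0 res1.
  apply: growing0 => //.
  - move=> x gx; rewrite /res1; case E: (seed x) => [t|//].
    by have [ht Ex] := (seedP x t).1 E; rewrite Ex d_c in gx.
  - by move=> x t ht /res0_home.
  - by move=> t ht; rewrite /res1 seed_c.
  - move=> x t gx; rewrite /res1; case E: (seed x) => [q|];
    last by rewrite res0_region.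
    by move=> [<-]; apply/seedP.
have cl1 t : home t = j -> class res1 t = [set c t].
  move=> ht; rewrite -cl //; apply/setP=> x; rewrite !inE /res1.
  case E: (seed x) => [//|]; apply/negbTE/eqP => /res0_home.
  by rewrite ht.
(* Invariant of the confined growth, with [hl] the assignment left by pulling. *)
pose P1 (r : G -> option 'I_k) :=
  forall t, home t = j -> class r t \subset class hl t.
have I4 : inv_grow P1 (ar s4) (ar s4).
  exists res1; first split=> //.
    by move=> t ht; rewrite cl1 // sub1set inE ht4.
  split=> // t ht; rewrite cl1 // cards1 ag4 // ag3 //.
  by have [] := cf2 t ht.
have := @run_grow P1 (fun w q => hl w == Some q)
  (fun a u w => a HOLD w == a RES u) (g_grow && (HOLD@[$vW] == RES@[$vU]))%E
  (ar s4) st4 _ _ _ s4 c4 I4.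
set s5 := run n L (sat2 _ _ _ (g_grow && _)%E _) s4.
case=> [s'|a u w q ag E|r u w q Pr _ hw|c5 ag5 [res [gr5 P5 stuck5] [rs5 fc5]]].
- by rewrite /= !bool_neq0.
- by rewrite E ag // hd4 code_eqS.
- move=> t ht; rewrite class_move; case: (eqVneq t q) => [E|_].
    rewrite subUset sub1set inE E hw /=; rewrite E in ht; exact: Pr.
  by apply: subset_trans (subD1set _ _) (Pr t ht).
have st5 : static d (ar s5).
  by apply: static_agree st4; apply: agreeW ag5 => t; rewrite /same_grow; lia.
(* Free growth preserves this: the guard stops a full class, and a class never gives up a dominating
   part. *)
pose P2 (r : G -> option 'I_k) := forall t, home t = j -> #|class r t| = N t \/
  exists2 b, grp b = j & part d b \subset class r t.
have P2_5 : P2 res.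
  move=> t ht; have [|||E|sub] := growing_held (hold := hl) gr5 P5 _ _ _ ht.
  - exact: cn4.
  - by move=> x q /hh4[].
  - by move=> u w q /stuck5/eqP.
  - by left.
  have [le|[b gb sb]] := en4 t ht.
    left; apply/eqP; rewrite eqn_leq (gro_card gr5) //=.
    exact: leq_trans le (subset_leq_card sub).
  by right; exists b => //; apply: subset_trans sub.
have I5 : inv_grow P2 (ar s5) (ar s5) by exists res.
have := @run_grow P2 (fun w q => true) (fun a u w => true) g_grow
  (ar s5) st5 _ _ _ s5 c5 I5.
set s6 := run n L (sat2 _ _ _ g_grow _) s5.
case=> [s'|//|r u w q Pr cg _|c6 ag6 [res' [gr6 P6 stuck6] [rs6 fc6]]].
- by rewrite andbT.
- move=> t ht; have [hu hw _ _ lt] := cg; rewrite class_upd_at ?hw //.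
  case: (Pr t ht) => [E|[b gb sb]].
    left; case: eqP => [E2|//]; by rewrite E2 E ltnn in lt.
  right; exists b => //; case: eqP => // _.
  exact: subset_trans sb (subsetUr _ _).
split=> //.
  move=> t i lt; rewrite ag6; last by rewrite /same_grow lt.
  rewrite ag5; last by rewrite /same_grow lt.
  rewrite ag4; last by rewrite /same_pull; lia.
  rewrite ag3; last by rewrite /same_colour; lia.
  by rewrite ag2 ?lt // ag1 //; lia.
exists res'; split=> //.
apply: (growing_done cds_part size_region gr6 P6) => u w q /stuck6.
by [].
Qed.

End Group.

(** * Measuring a group and moving its leftovers *)

Lemma card_rk_ltS (Q : pred G) x :
  #|[set y | (rk y < (rk x).+1) && Q y]|
  = #|[set y | (rk y < rk x) && Q y]| + Q x.
Proof.
case Qx: (Q x); last first.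
  rewrite addn0; apply: eq_card => y; rewrite !inE ltnS leq_eqVlt rk_eq.
  by case: eqP => // ->; rewrite Qx ltnn.
rewrite (cardsD1 x) !inE ltnSn Qx addnC; congr (_ + _).
apply: eq_card => y; rewrite !inE ltnS [_ <= _]leq_eqVlt rk_eq.
by case: eqP => // ->; rewrite ltnn.
Qed.

Lemma run_count d s j : ctx j s -> static d (ar s) ->
  let s' := run n L p_count s in
  [/\ ctx j s', ar s' = ar s, va s' vA = #|[set x | (grp (d x) : nat) == j]|
    & va s' vB = \sum_(t : 'I_k | (home t : nat) == j) N t].
Proof.
move=> cs st; have -> : run n L p_count s =
  run n L p_need (run n L p_region (setv (setv s vA 0) vB 0)) by [].
set s1 := setv _ vB 0; cbv zeta.
have c1 : ctx j s1 by rewrite /s1; do 2!apply: ctx_ignores => //.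
pose I m s2 := [/\ ctx j s2, ar s2 = ar s, va s2 vB = 0
  & va s2 vA = #|[set x | (rk x < m) && ((grp (d x) : nat) == j)]|].
have : I n (run n L p_region s1).
  apply: run_for => [|m s2 hm [c2 a2 b2 e2]].
    by split=> //; apply/esym/eqP; rewrite cards_eq0; apply/eqP/setP => x;
      rewrite !inE.
  have [x ex] := rk_surj hm; rewrite ex.
  have c3 : ctx j (setv s2 vU (rk x)) by apply: ctx_ignores.
  have [_ ej _] := c3; move: ej; rewrite /= /upd /= => ej.
  rewrite a2 (st_dom st) (st_grp st) ej bool_neq0.
  by case: ifP => h; split=> //=;
    rewrite ?card_rk_ltS ?h /upd //= ?e2 ?addn0 ?ex //.
  case=> c2 a2 b2 e2; set s2 := run n L p_region s1 in c2 a2 b2 e2 *.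
pose J m s3 := [/\ ctx j s3, ar s3 = ar s, va s3 vA = va s2 vA
  & va s3 vB = \sum_(t : 'I_k | (t < m) && ((home t : nat) == j)) N t].
have : J n (run n L p_need s2).
  apply: run_for => [|m s3 hm [c3 a3 b3 e3]].
    by split=> //; rewrite b2 big1.
  have c4 : ctx j (setv s3 vU m) by apply: ctx_ignores.
  have [ek ej _] := c4; move: ek ej; rewrite /= /upd /= => ek ej.
  rewrite ek ej a3 !bool_neq0 !addn1.
  have skip : (forall t : 'I_k, t = m :> nat -> (home t : nat) == j = false) ->
      J m.+1 (setv s3 vU m).
    move=> no; split=> //=; rewrite /upd /= e3; apply: eq_bigl => t.
    by rewrite ltnS [t <= m]leq_eqVlt; case: (nat_of_ord t =P m) => // Et;
      rewrite (no t Et) !andbF.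
  have [mk|mk] := ltnP m k; last first.
    by apply: skip => t E; have := ltn_ord t; rewrite E ltnNge mk.
  have hom := st_home st (Ordinal mk); rewrite /= in hom; rewrite hom.
  have sz := st_sz st (Ordinal mk); rewrite /= in sz.
  case E: (_ == j); last first.
    apply: skip => t Et; rewrite -E; congr ((home _ : nat) == j).
    exact: val_inj.
  split=> //=;
    rewrite /upd /= e3 sz addnC [RHS](bigD1 (Ordinal mk)) /= ?ltnSn ?E //.
  congr (_ + _); apply: eq_bigl => t;
    rewrite ltnS [t <= m]leq_eqVlt -val_eqE /=.
  by case: (nat_of_ord t =P m) => [->|]; rewrite ?ltnn ?andbF ?andbT.
case=> c3 a3 b3 e3; split=> //; first rewrite b3 e2.
  by apply: eq_card => x; rewrite !inE rk_lt.
by rewrite e3; apply: eq_bigl => t; rewrite (leq_trans (ltn_ord t) k_le_n).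
Qed.

Lemma run_left d s (j : 'I_k) res : ctx j s -> static d (ar s) -> grp j = j ->
  (forall x, ar s RES (rk x) = code (res x)) ->
  (forall x, grp (d x) = j -> res x = None ->
     exists j' : 'I_k, [/\ grp j' = j', ar s SOL j' = 0 & j' <> j]) ->
  let s' := run n L p_left s in
  [/\ ctx j s', forall b : 'I_k, (ar s' SOL b != 0) = (b == j) || (ar s SOL b != 0),
      forall x, ar s' RES (rk x) = code (res x) & exists d',
    [/\ static d' (ar s'),
      forall x, ~~ ((grp (d x) == j) && (res x == None)) -> d' x = d x
    & forall x, (grp (d x) == j) && (res x == None) ->
       exists2 j' : 'I_k, [/\ grp j' = j', ar s SOL j' == 0 & j' <> j]
         & forall y, (grp (d y) == j) && (res y == None) -> d' y = j']].
Proof.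
move=> cs st gj rs leftover; have [ek ej ei] := cs.
pose c0 := For vW (When ((GRP@[DOM@[$vW]] == $vJ) && (RES@[$vW] == 0))%E
  (DOM@[$vW] ::= $vQ)).
have -> : run n L p_left s =
    run n L c0 (run n L p_next (setv (seta s SOL j 1) vQ (va s vK))).
  by rewrite -ej.
set s1 := setv _ vQ _; cbv zeta.
have c1 : ctx j s1 by split.
have sol1 (b : 'I_k) : (ar s1 SOL b == 0) = (b != j) && (ar s SOL b == 0).
  by rewrite /= upd2_eq val_eqE; case: (b == j).
have st1 : static d (ar s1).
  by apply: static_agree st => t i lt; rewrite /= upd2_ne //; lia.
have rs1 x : ar s1 RES (rk x) = code (res x) by rewrite /= upd2_ne.
pose good (b : 'I_k) := (grp b == b) && (ar s1 SOL b == 0).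
pose I m s2 := [/\ ctx j s2, ar s2 = ar s1
  & (va s2 vQ = k /\ forall b : 'I_k, b < m -> ~~ good b) \/
    (exists2 b : 'I_k, va s2 vQ = b & good b)].
have : I n (run n L p_next s1).
  apply: run_for => [|m s2 hm [c2 a2 q2]].
    by split=> //; left.
  have c3 : ctx j (setv s2 vU m) by apply: ctx_ignores.
  have [ek3 _ _] := c3; move: ek3; rewrite /= /upd /= => ek3.
  rewrite ek3 a2 !bool_neq0.
  have skip : (forall b : 'I_k, b = m :> nat -> ~~ good b) -> I m.+1 (setv s2 vU m).
    move=> no; split=> //=; case: q2 => [[q2 h2]|]; last by right.
    left; split=> // b; rewrite ltnS leq_eqVlt => /orP[/eqP/no//|]; exact: h2.
  have [mk|mk] := ltnP m k; last first.
    by apply: skip => b E; have := ltn_ord b; rewrite E ltnNge mk.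
  have gm := st_grp st1 (Ordinal mk); rewrite [X in ar s1 GRP X]/= in gm;
    rewrite gm.
  have goodE : good (Ordinal mk) = ((grp (Ordinal mk) : nat) == m) && (ar s1 SOL m == 0).
    by rewrite /good -val_eqE.
  rewrite [X in if X then _ else _]/= -goodE.
  case: ifP => h.
    by split=> //=; right; exists (Ordinal mk).
  apply: skip => b E; have -> : b = Ordinal mk by apply: val_inj.
  by rewrite h.
set s2 := run n L p_next s1 => -[c2 a2 q2].
pose P x := (grp (d x) == j) && (res x == None).
(* The default [j] is never taken: as soon as some vertex satisfies [P], an open group exists and
   [vQ] holds its base. *)
pose d' x := if P x then insubd j (va s2 vQ) else d x.
have q2' x : P x -> exists2 b : 'I_k, va s2 vQ = b & good b.
  move=> /andP[/eqP gx /eqP rx]; case: q2 => [[_ no]|//].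
  have [j' [g' s' n']] := leftover x gx rx;
    case/negP: (no j' (leq_trans (ltn_ord j') k_le_n)).
  by rewrite /good g' sol1 s' !eqxx andbT; apply/eqP.
pose J m s3 := [/\ ctx j s3, va s3 vQ = va s2 vQ,
  forall t i, t != DOM -> ar s3 t i = ar s1 t i
  & forall x, ar s3 DOM (rk x) = if rk x < m then d' x else d x].
set s3 := run n L c0 s2.
have [c3 _ ag3 dm3] : J n s3.
  apply: run_for => [|m s4 hm [c4 q4 ag4 dm4]].
    by split=> // [t i|x]; rewrite a2 // (st_dom st1).
  have [x ex] := rk_surj hm; rewrite ex.
  have c5 : ctx j (setv s4 vW (rk x)) by apply: ctx_ignores.
  have [_ ej5 _] := c5; move: ej5; rewrite /= /upd /= => ej5.
  rewrite dm4 ex ltnn !ag4 // (st_grp st1) ej5 rs1 !bool_neq0 val_eqE code_eq0 -/(P x).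
  have dE y : y != x -> (rk y < (rk x).+1) = (rk y < rk x).
    by move=> yx; rewrite ltnS leq_eqVlt rk_eq (negPf yx).
  case: ifP => Px.
    split=> //=.
    + by move=> t i ht; rewrite upd2_ne // ag4.
    + move=> y; rewrite upd2_eq rk_eq; case: eqVneq => [->|yx].
        rewrite ltnSn /d' Px q4; have [b -> _] := q2' x Px.
        by rewrite /insubd insubT.
      by rewrite dm4 ex dE.
  split=> //= y; rewrite dm4 ex; have [->|yx] := eqVneq y x.
    by rewrite ltnn ltnSn /d' Px.
  by rewrite dE.
split=> //.
- by move=> b; rewrite ag3 // -[_ != 0]/(~~ _) sol1 negb_and negbK.
- by move=> x; rewrite ag3.
exists d'; split.
- have [h1 h2 h3 h4 h5 h6] := st1.
  split; try by move=> *; rewrite ag3 //;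
    (apply: h1 || apply: h3 || apply: h4 || apply: h5 || apply: h6).
  by move=> x; rewrite dm3 rk_lt.
- by move=> x; rewrite /d' /P => /negPf->.
- move=> x Px; have [b qb /andP[/eqP gb]] := q2' x Px.
  rewrite sol1 => /andP[/eqP bj sb]; exists b => // y Py.
  by rewrite /d' /P Py qb; apply: val_inj; rewrite val_insubd ltn_ord.
Qed.

(** * The main loop *)

Hypothesis grp_home : forall s, grp (home s) = home s.
Hypothesis home_grp : forall b, exists s, home s = grp b.
Hypothesis card_grp : forall j, #|[set b | grp b == j]| = #|mates home j|.
Hypothesis sum_N : \sum_s N s = n.

Definition inv_main (a : nat -> nat -> nat) : Prop :=
  exists d res, [/\ static d a, forall x, a RES (rk x) = code (res x)
    & partial_solution c N home grp d res (fun b => a SOL b != 0)].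

Definition solved (a : nat -> nat -> nat) : nat := #|[set b : 'I_k | a SOL b != 0]|.

(** The idle condition for one turn of the main loop, phrased through the arrays alone as saturation
    demands. *)
Definition short (i : nat) (a : nat -> nat -> nat) : Prop :=
  forall j : 'I_k, j = i :> nat -> grp j = j -> a SOL j = 0 ->
  #|[set x | a GRP (a DOM (rk x)) == j]| < \sum_(t in mates home j) N t.

Lemma run_solve s (j : 'I_k) : ctx j s -> inv_main (ar s) -> grp j = j ->
  ar s SOL j = 0 ->
  \sum_(t in mates home j) N t <= #|[set x | ar s GRP (ar s DOM (rk x)) == j]| ->
  let s' := run n L p_solve s in
  [/\ ctx j s', inv_main (ar s') & solved (ar s) < solved (ar s')].
Proof.
move=> cs [d [res [st rs ps]]] gj sj size_j.
have sj' : ~~ (ar s SOL j != 0) by rewrite sj.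
have size_r : \sum_(t in mates home j) N t <= #|region grp d j|.
  apply: leq_trans size_j _; apply: eq_leq; apply: eq_card => x.
  by rewrite !inE (st_dom st) (st_grp st) val_eqE.
have d_c t : home t = j -> d (c t) = j.
  by move=> ht; rewrite (par_term ps) ht // sj.
have := @run_group d j res gj _ (card_grp j) _ d_c size_r _ _ s cs st rs.
case.
- by have [t ht] := home_grp j; exists t; rewrite ht gj.
- by move=> b gb; apply: (par_cds ps); rewrite gb sj.
- by move=> x gx; apply: (par_none ps); rewrite gx sj.
- by move=> x t rx ht; have := par_home ps rx; rewrite ht => E;
    move: rx; rewrite (par_none ps) // -E sj.
rewrite /p_solve [run _ _ (Seq _ _) s]/(run n L p_left (run n L p_group s)).
set s1 := run n L p_group s => c1 ag1 [res' [gr rs1 full]].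
have st1 : static d (ar s1).
  by apply: static_agree st; apply: agreeW ag1 => t; lia.
have sol1 b : ar s1 SOL b = ar s SOL b by rewrite ag1.
have leftover x : grp (d x) = j -> res' x = None ->
    exists j' : 'I_k, [/\ grp j' = j', ar s1 SOL j' = 0 & j' <> j].
  move=> gx rx.
  have [j' [g' s' n']] := leftover_group grp_home home_grp sum_N ps gj sj' gr full gx rx.
  by exists j'; split=> //; rewrite sol1; apply/eqP; rewrite -[_ == _]negbK.
have := run_left c1 st1 gj rs1 leftover.
set s2 := run n L p_left s1 => -[c2 sol2 rs2 [d' [st2 dN dP]]].
split=> //.
  exists d', res'; split=> //.
  apply: (partial_solution_step grp_home ps gj sj' gr full _ dN) => //.
    by move=> b; rewrite sol2 sol1.
  move=> x /dP[j' [g' s' n'] E]; exists j' => //; split=> //.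
  by rewrite -sol1 s'.
apply: proper_card; apply/properP; split.
  by apply/subsetP=> b; rewrite !inE sol2 sol1 => ->; rewrite orbT.
by exists j; rewrite !inE ?sol2 ?eqxx // sj.
Qed.

Definition ctx_main (s : store) : Prop := va s vK = k /\ lo s = inp.

(** The measure is the number of served groups. In a saturated state every open group is deficient,
    which averaging forbids as soon as one group is open; so none is. *)
Lemma run_main s : ctx_main s -> inv_main (ar s) ->
  let s' := run n L p_main s in
  [/\ ctx_main s', inv_main (ar s') & forall b : 'I_k, ar s' SOL (grp b) != 0].
Proof.
move=> cs Is.
have solved_le a : inv_main a -> solved a <= n.
  by move=> _; apply: leq_trans (max_card _) _; rewrite card_ord k_le_n.
have ign x : x != vK -> ignores ctx_main x.
  by move=> xK s1 v [e1 e2]; split; rewrite /= ?/upd // eq_sym (negPf xK).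
have := @saturates n L inv_main solved solved_le ctx_main vP (For vJ p_step)
  (fun a => forall i, i < n -> short i a) s (ign vP isT) _ cs Is.
case=> [|c1 I1 idle].
  apply: progresses_for; first exact: ign.
  move=> i hi s1 [[ek ei] ej] I1.
  have cj : ctx i s1 by split.
  have [d [res [st rs ps]]] := I1.
  have skip s2 : ar s2 = ar s1 -> ctx_main s2 -> va s2 vJ = i -> short i (ar s1) ->
      [/\ ctx_main s2 /\ va s2 vJ = i, inv_main (ar s2), short i (ar s1) -> ar s2 = ar s1
        & ar s2 = ar s1 /\ short i (ar s1) \/ solved (ar s1) < solved (ar s2)].
    by move=> E c2 e2 sh; split; rewrite ?E //; left.
  have gE : (ev L g_main s1 != 0) =
      [&& i < k, ar s1 GRP i == i & ar s1 SOL i == 0].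
    by rewrite /= ek ej !bool_neq0.
  have -> : run n L p_step s1 = if ev L g_main s1 != 0 then
      let s2 := run n L p_count s1 in
      if (va s2 vA < va s2 vB : nat) != 0 then s2 else run n L p_solve s2
    else s1 by [].
  rewrite gE; cbv zeta.
  case: ifP => [/and3P[ik /eqP gi /eqP si]|no]; last first.
    apply: skip => // j E gj sj; case/negP: no.
    by rewrite -E ltn_ord (st_grp st) gj eqxx sj.
  have Ei : (Ordinal ik : 'I_k) = i :> nat by [].
  have gj : grp (Ordinal ik) = Ordinal ik.
    by apply: ord_inj; rewrite -(st_grp st) /= gi.
  have [] := run_count cj st.
  set s2 := run n L p_count s1 => c2 a2 va2 vb2.
  rewrite va2 vb2.
  have [ek2 ej2 ei2] := c2.
  have regE : #|[set x | (grp (d x) : nat) == i]| =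
      #|[set x | ar s1 GRP (ar s1 DOM (rk x)) == Ordinal ik]|.
    by apply: eq_card => x; rewrite !inE (st_dom st) (st_grp st).
  have needE : \sum_(t : 'I_k | (home t : nat) == i) N t =
      \sum_(t in mates home (Ordinal ik)) N t.
    by apply: eq_bigl => t; rewrite inE -val_eqE.
  rewrite bool_neq0 regE needE; case: ltnP => lt.
    apply: skip => // j E gj' sj.
    by have -> : j = Ordinal ik by apply: val_inj.
  have I2 : inv_main (ar s2) by rewrite a2.
  have := run_solve (j := Ordinal ik) (s := s2) c2 I2 gj;
    rewrite a2 => /(_ si lt).
  set s3 := run n L p_solve s2 => -[c3 I3 lt3].
  have [ek3 ej3 ei3] := c3.
  split=> //; last by right.
  by move=> /(_ (Ordinal ik) Ei gj si); rewrite ltnNge lt.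
split=> // b; apply/negP => sb.
have [d [res [st rs ps]]] := I1.
have sb' : ~~ (ar (run n L p_main s) SOL (grp b) != 0) by rewrite negbK.
have [j [gj sj]] := surplus_group grp_home home_grp sum_N ps (grp_idem grp_home home_grp b) sb'.
rewrite leqNgt => /negP; apply.
have h := idle j (leq_trans (ltn_ord j) k_le_n) j erefl gj.
apply: leq_trans (h _); last by apply/eqP; rewrite -[_ == _]negbK.
rewrite ltnS; apply: eq_leq; apply: eq_card => x.
by rewrite !inE (st_dom st) (st_grp st) val_eqE.
Qed.

End Static.

(** * Reading the input into arrays *)

Let home (s : 'I_k) : 'I_k := d0 (c s).

Lemma run_mul s : ctx 0 s -> (forall i, ar s MUL i = 0) ->
  let s' := run n L p_mul s in
  [/\ ctx 0 s', agree (fun t => t != MUL) (ar s) (ar s')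
    & forall u, u <= n -> ar s' MUL u = u * n].
Proof.
move=> cs z; pose I m s' := [/\ ctx 0 s',
  agree (fun t => t != MUL) (ar s) (ar s') & forall u, u <= m -> ar s' MUL u = u * n].
apply: (run_for (I := I)) => [|m s1 hm [c1 ag h]].
  by split=> // u; rewrite leqn0 => /eqP->; rewrite z.
have c2 : ctx 0 (setv s1 vU m) by apply: ctx_ignores.
rewrite /= /upd !eqxx (ctx_flat c2) // inp0; split.
- by case: c2.
- by apply: agree_upd2.
- move=> u; rewrite /= upd2_eq addn1; case: eqP => [-> _|ne hu].
    by rewrite h // mulSn addnC.
  by apply: h; lia.
Qed.

Lemma run_dom s : ctx 0 s -> (forall u, u <= n -> ar s MUL u = u * n) ->
  let s' := run n L p_dom s in
  [/\ ctx 0 s', agree (fun t => t != DOM) (ar s) (ar s')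
    & forall x, ar s' DOM (rk x) = d0 x].
Proof.
move=> cs hm.
pose ok (Q : G -> Prop) s' := [/\ ctx 0 s',
  agree (fun t => t != DOM) (ar s) (ar s') & forall x, Q x -> ar s' DOM (rk x) = d0 x].
have : ok (fun x => d0 x < n) (run n L p_dom s).
  apply: (run_for (I := fun m => ok (fun x => d0 x < m))) => [|i s1 hi [c1 ag1 h1]].
    by split.
  pose J m s' := va s' vU = i /\ ok (fun x => d0 x < i \/ d0 x = i :> nat /\ rk x < m) s'.
  have [_ [c3 ag3 h3]] : J n (run n L (For vW (When (($vU < $vK) &&
      EM (2 + (MUL@[EM 0] + ($vK + ($vK + (MUL@[$vU] + $vW))))))%E
    (DOM@[$vW] ::= $vU))) (setv s1 vU i)).
    apply: run_for => [|m s2 hmn [vU2 [c2 ag2 h2]]].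
      split; first by rewrite /= /upd eqxx.
      by split; [exact: ctx_ignores | exact: ag1 | move=> x [/h1|[]]].
    have c4 : ctx 0 (setv s2 vW m) by apply: ctx_ignores.
    have [ek _ _] := c4; move: ek; rewrite /= /upd /= => ek.
    rewrite ek vU2 [flat _ _ 0](ctx_flat c4) // inp0 !ag2 // !hm //;
      last exact: ltnW.
    have [x ex] := rk_surj hmn; subst m.
    have [ik|ik] := ltnP i k; last first.
      split=> //=; split=> // y [lt|[E _]]; first by apply: h2; left.
      by have := ltn_ord (d0 y); rewrite E ltnNge ik.
    rewrite (ctx_flat c4); last by have := rk_lt x; rewrite /L; nia.
    rewrite (inp_dom (Ordinal ik)) !bool_neq0 /=.
    have yE y : y <> x -> rk y < (rk x).+1 -> rk y < rk x.
      move=> yx; rewrite ltnS leq_eqVlt => /orP[|//].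
      by rewrite rk_eq => /eqP.
    case: eqP => dx.
      split; first by [].
      split=> [||y]; [by case: c4 | by apply: agree_upd2 | ].
      rewrite /= upd2_eq rk_eq; case: eqP => [-> _|yx hy].
        by rewrite dx.
      apply: h2; case: hy => [lt|[E lt]]; [by left | right].
      by split=> //; apply: yE.
    split=> //=; split=> // y hy.
    apply: h2; case: hy => [lt|[E lt]]; [by left | right].
    split=> //; apply: yE => // Ey; case: dx.
    by apply: ord_inj; rewrite -Ey E.
  split=> // x lt; apply: h3; move: lt; rewrite ltnS leq_eqVlt.
  by case/orP=> [/eqP|]; [right; rewrite rk_lt | left].
case=> c1 ag h; split=> // x; apply: h.
exact: leq_trans (ltn_ord _) k_le_n.
Qed.

Lemma run_term s : ctx 0 s -> (forall u, u <= n -> ar s MUL u = u * n) ->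
  (forall x, ar s DOM (rk x) = d0 x) ->
  let s' := run n L p_term s in
  [/\ ctx 0 s', agree (fun t => (t < 2) || (4 < t)) (ar s) (ar s')
    & forall t : 'I_k, [/\ ar s' SZ t.+1 = N t, ar s' HOME t.+1 = home t
                         & ar s' TERM t.+1 = rk (c t)]].
Proof.
move=> cs hm hd.
pose I m s' := [/\ ctx 0 s', agree (fun t => (t < 2) || (4 < t)) (ar s) (ar s')
    & forall t : 'I_k, t < m -> [/\ ar s' SZ t.+1 = N t, ar s' HOME t.+1 = home t
                         & ar s' TERM t.+1 = rk (c t)]].
have [c1 ag1 h1] : I n (run n L p_term s).
  apply: run_for => [|m s1 hmn [c1 ag1 h1]]; first by split.
  have c2 : ctx 0 (setv s1 vU m) by apply: ctx_ignores.
  have [ek ej ei] := c2; move: ek ej ei; rewrite /= /upd /= => ek ej ei.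
  rewrite ek bool_neq0; have [mk|mk] := ltnP m k; last first.
    by split=> // t _; apply: h1; apply: leq_trans mk.
  have flatE s2 i : lo s2 = inp -> i < L -> flat L s2 i = inp i.
    by move=> E lt; rewrite /flat lt E.
  have b1 : 2 + (n * n + (k + m)) < L by rewrite /L; nia.
  have b2 : 2 + (n * n + m) < L by rewrite /L; nia.
  have f0 s2 : lo s2 = inp -> flat L s2 0 = n by move=> E;
    rewrite flatE // inp0.
  rewrite /= !f0 // addn1 !(upd2_eq, upd2_ne) // eqxx !ag1 // !hm // !flatE //.
  rewrite (inp_size (Ordinal mk)) (inp_term (Ordinal mk)) hd.
  split; first by split.
    by do !apply: agree_upd2.
  move=> t; rewrite /= !(upd2_eq, upd2_ne) // eqSS ltnS leq_eqVlt.
  case: (nat_of_ord t =P m) => [E _|ne /= /h1//].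
  by have -> : Ordinal mk = t by apply: val_inj; rewrite /= E.
split=> // t; apply: h1; exact: leq_trans (ltn_ord t) k_le_n.
Qed.

(** * Matching terminals with parts *)

Section Matching.

Variables (P : ('I_k -> option 'I_k) -> Prop) (X : 'I_k -> 'I_k -> bool).
Variables (Xa : (nat -> nat -> nat) -> nat -> nat -> bool) (ge : exp).
Variable a1 : nat -> nat -> nat.

Definition same_match (t : nat) : bool := (t < 5) || (7 < t).

Hypothesis home1 : forall s : 'I_k, a1 HOME s.+1 = home s.
Hypothesis geE : forall s, (ev L ge s != 0) =
  (ev L g_match s != 0) && Xa (ar s) (va s vU) (va s vW).
Hypothesis XaE : forall a (s b : 'I_k), agree same_match a1 a -> Xa a s b = X s b.
Hypothesis P_step : forall sig s b, P sig -> sig s = None -> X s b ->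
  P (upd_at sig s (Some b)).

Definition inv_match (a : nat -> nat -> nat) : Prop :=
  exists2 sig, P sig &
  [/\ forall s t b, sig s = Some b -> sig t = Some b -> s = t,
      forall s : 'I_k, a SIG s.+1 = code (sig s),
      forall b : 'I_k, (a TAK b != 0) = [exists s, sig s == Some b],
      forall (s b : 'I_k), sig s = Some b -> a GRP b = home s
    & agree same_match a1 a].

Definition taken (a : nat -> nat -> nat) : nat := #|[set b : 'I_k | a TAK b != 0]|.

Definition G_match (a : nat -> nat -> nat) (u w : nat) : bool :=
  [&& u < k, w < k, a SIG u.+1 == 0 & a TAK w == 0] && Xa a u w.

(** Serves both sweeps: [X] restricts the admissible pairs, to a terminal and its own part in the
    first sweep and not at all in the second. *)
Lemma run_match s : ctx 0 s -> inv_match (ar s) ->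
  let s' := run n L (sat2 vP vU vW ge c_match) s in
  [/\ ctx 0 s', agree same_match a1 (ar s') & exists2 sig,
    P sig /\ (forall s b, sig s = None -> (forall t, sig t <> Some b) -> ~~ X s b) &
    [/\ forall s t b, sig s = Some b -> sig t = Some b -> s = t,
      forall s : 'I_k, ar s' SIG s.+1 = code (sig s),
      forall b : 'I_k, (ar s' TAK b != 0) = [exists s, sig s == Some b]
    & forall (s b : 'I_k), sig s = Some b -> ar s' GRP b = home s]].
Proof.
move=> cs Is /=.
have [|||||||||c1 I1 stuck] := @sat2P n L inv_match taken _ (ctx 0) vP vU vW
  ge c_match G_match s; rewrite ?ctx_ignores //.
- by move=> a _; apply: leq_trans (max_card _) _; rewrite card_ord k_le_n.
- move=> s1 c1 I1 hu hw; have [ek _ _] := c1.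
  by rewrite geE /= !bool_neq0 ek addn1.
- move=> s1 c1 [sig Ps [l1 l2 l3 l4 ag]] hu hw /andP[/and4P[ku kw]].
  rewrite (l2 (Ordinal ku)) code_eq0 -[_ == 0]negbK (l3 (Ordinal kw)).
  move=> /eqP sN /existsPn free.
  rewrite (XaE (Ordinal ku) (Ordinal kw) ag) => xb.
  pose u := Ordinal ku; pose b := Ordinal kw.
  have sb t : sig t <> Some b by move=> E; have := free t; rewrite E eqxx.
  rewrite /= addn1 -[va s1 vU]/(u : nat) -[va s1 vW]/(b : nat).
  split=> //.
  + exists (upd_at sig u (Some b)); first exact: P_step.
    split.
    * move=> t t' b'; rewrite /upd_at; case: eqP => [->|_];
      case: eqP => [->|_] //.
      - by move=> [<-] /sb.
      - by move=> hb [E]; rewrite -E in hb; case: (sb t).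
      - exact: l1.
    * move=> t; rewrite !(upd2_eq, upd2_ne) // eqSS val_eqE /upd_at.
      by case: ifP => // _; rewrite addn1.
    * move=> b'; rewrite !(upd2_eq, upd2_ne) // val_eqE;
      case: (b' =P b) => [->|ne].
        by apply/esym/existsP; exists u; rewrite /upd_at eqxx.
      rewrite l3; apply/existsP/existsP => -[t]; rewrite /upd_at.
        by move=> /eqP E; exists t; case: (t =P u) => [Et|_];
          [rewrite Et sN in E | rewrite E].
      by case: (t =P u) => [_ /eqP[/esym]//|_ E]; exists t.
    * move=> t b'; rewrite !(upd2_eq, upd2_ne) // val_eqE /upd_at.
      case: (t =P u) => [-> [<-]|_ E].
        by rewrite eqxx ag // home1.
      by case: (b' =P b) => [Eb|_]; [rewrite Eb in E; case: (sb t) | apply: l4].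
    * by do !apply: agree_upd2.
  + apply: proper_card; apply/properP; split.
      by apply/subsetP=> b'; rewrite !inE !(upd2_eq, upd2_ne) //; case: ifP.
    exists b; rewrite !inE ?(upd2_eq, upd2_ne) // ?eqxx // negbK.
    by rewrite -[_ == 0]negbK l3; apply/existsPn => t; apply/eqP/sb.
have [sig Ps [l1 l2 l3 l4 ag]] := I1.
split=> //; exists sig; last by split.
split=> // t b sN sb; apply/negP => xb.
have /negP := stuck t b (leq_trans (ltn_ord t) k_le_n) (leq_trans (ltn_ord b) k_le_n).
apply; rewrite /G_match !ltn_ord l2 sN (XaE _ _ ag) xb /= andbT.
by rewrite -[_ == 0]negbK l3; apply/existsPn => q; apply/eqP/sb.
Qed.

End Matching.

(** The final matching [sg] is a bijection and [grp] is [home] composed with its inverse. Hence [sg]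
    carries the terminals of home j onto the parts of group j, which gives the equality of
    cardinalities. *)
Lemma run_matching s : ctx 0 s -> (forall s' : 'I_k, ar s HOME s'.+1 = home s') ->
  (forall i, ar s SIG i = 0) -> (forall i, ar s TAK i = 0) ->
  let s' := run n L p_match s in
  [/\ ctx 0 s', agree same_match (ar s) (ar s') & exists grp : 'I_k -> 'I_k,
    [/\ forall b : 'I_k, ar s' GRP b = grp b,
        forall t, grp (home t) = home t,
        forall b, exists t, home t = grp b
      & forall j, #|[set b | grp b == j]| = #|mates home j|]].
Proof.
move=> cs hs zs zt.
have -> : run n L p_match s = run n L (sat2 vP vU vW g_match c_match)
  (run n L (sat2 vP vU vW (g_match && (HOME@[$vU + 1] == $vW))%E c_match) s) by [].
pose P1 (sig : 'I_k -> option 'I_k) := forall t b, sig t = Some b -> b = home t.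
(* After the first sweep every home part is matched with one of its own terminals. The second sweep
   only adds pairs, so this survives and yields [grp (home t) = home t]. *)
pose P2 (sig : 'I_k -> option 'I_k) :=
  forall t, exists2 q, sig q = Some (home t) & home q = home t.
have I0 : inv_match P1 (ar s) (ar s).
  exists (fun=> None) => //; split=> // b; rewrite zt.
  by apply/esym/existsP => -[].
have [s1|||c1 ag1 [sig1 [Q1 full1] [l1 l2 l3 l4]]] := @run_match P1
  (fun t b => home t == b) (fun a u w => a HOME u.+1 == w)
  (g_match && (HOME@[$vU + 1] == $vW))%E (ar s) hs _ _ _ s cs I0.
- by rewrite /= !bool_neq0 addn1.
- by move=> a t b ag; rewrite ag // hs val_eqE.
- move=> sig t b Ps _ /eqP hb q b'; rewrite /upd_at; case: eqP => [-> [<-]//|_].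
  exact: Ps.
move: c1 ag1 l2 l3 l4; set s1 := run n L _ s => c1 ag1 l2 l3 l4.
have P2_1 : P2 sig1.
  move=> t;
    have [/existsP[q /eqP hq]|no] := boolP [exists q, sig1 q == Some (home t)].
    by exists q => //; rewrite -(Q1 q _ hq).
  case E: (sig1 t) => [b|].
    by exists t => //; rewrite E (Q1 t b E).
  have := full1 t (home t) E; rewrite eqxx => h; suff: ~~ true by [].
  by apply: h => q hq; case/negP: no; apply/existsP; exists q; apply/eqP.
have hs1 (t : 'I_k) : ar s1 HOME t.+1 = home t by rewrite ag1.
have I1 : inv_match P2 (ar s1) (ar s1) by exists sig1.
have [s2|//|sig t b Ps sN _ q|c2 ag2 [sig [Q2 full2] [m1 m2 m3 m4]]] := @run_match P2
  (fun t b => true) (fun a u w => true) g_match (ar s1) hs1 _ _ _ s1 c1 I1.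
- by rewrite andbT.
- have [r hr1 hr2] := Ps q; exists r => //; rewrite /upd_at.
  by case: eqP => // E; rewrite -E hr1 in sN.
have sig_inj t t' : sig t <> None -> sig t = sig t' -> t = t'.
  by case E: (sig t) => [b|//] _ E'; apply: (m1 t t' b).
(* With t unmatched every part would be taken; sending each part to its terminal is an injection of
   ['I_k] into itself, hence onto, so t would be matched after all. *)
have tot t : sig t <> None.
  move=> sN; have all_taken b : exists q, sig q == Some b.
    apply/existsP; apply: contraT => /existsPn no.
    by have := full2 t b sN (fun q E => negP (no q) (introT eqP E)).
  pose q b := xchoose (all_taken b).
  have qE b : sig (q b) = Some b by apply/eqP/(xchooseP (all_taken b)).
  have q_inj : injective q by move=> b b' E; have := qE b; rewrite E qE => -[].
  have [q' _ q'K] := injF_bij q_inj.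
  by have := qE (q' t); rewrite q'K sN.
pose sg t := odflt t (sig t).
have sgE t : sig t = Some (sg t) by rewrite /sg; case: (sig t) (tot t).
have sg_inj : injective sg.
  by move=> t t' E; apply: sig_inj => //; rewrite !sgE E.
pose sgV := invF sg_inj.
have grpE (b : 'I_k) : ar (run n L (sat2 vP vU vW g_match c_match) s1) GRP b = home (sgV b).
  by apply: m4; rewrite sgE f_invF.
split=> //; first by apply: agree_trans ag1 ag2.
exists (fun b => home (sgV b)); split=> //.
- move=> t; have [q hq1 hq2] := Q2 t; rewrite -{2}hq2; congr home.
  by apply: (@sg_inj); rewrite f_invF; have := sgE q; rewrite hq1 => -[].
- by move=> b; exists (sgV b).
- move=> j; rewrite -(card_imset (mates home j) sg_inj); apply: eq_card => b.
  rewrite !inE; apply/eqP/imsetP => [E|[t ht ->]].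
    by exists (sgV b); rewrite ?inE ?E ?f_invF.
  by move: ht; rewrite inE /sgV invF_f => /eqP.
Qed.

(** * Writing the answer, and correctness of the whole program *)

Lemma addr_eq t u x y : (t * n + rk x == u * n + rk y) = (t == u) && (x == y).
Proof.
apply/eqP/andP => [E|[/eqP-> /eqP->]//].
have hx := rk_lt x; have hy := rk_lt y.
have tu : t = u.
  by apply/eqP; rewrite eqn_leq; apply/andP; split; rewrite leqNgt;
    apply/negP; nia.
by subst u; move/addnI: E => /rk_inj->.
Qed.

Lemma run_out s res : va s vK = k -> (forall u, u <= n -> ar s MUL u = u * n) ->
  (forall x, ar s RES (rk x) = code (res x)) ->
  let s' := run n L p_out s in
  va s' vO = k * n /\
  forall (t : 'I_k) x, lo s' (t * n + rk x) = (x \in class res t).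
Proof.
move=> ek hm hr.
pose ok (Q : 'I_k -> G -> Prop) s' := [/\ va s' vK = k, ar s' = ar s
  & forall t x, Q t x -> lo s' (t * n + rk x) = (x \in class res t)].
have : ok (fun t _ => t < n) (run n L p_write s).
  apply: (run_for (I := fun m => ok (fun t _ => t < m))) => [|i s1 hi [k1 a1 h1]].
    by split.
  pose J m s' := va s' vU = i /\ ok (fun t x => t < i \/ t = i :> nat /\ rk x < m) s'.
  have [_ [k3 a3 h3]] : J n (run n L (For vW (When ($vU < $vK)%E
      (SetM (MUL@[$vU] + $vW)%E (RES@[$vW] == $vU + 1)%E))) (setv s1 vU i)).
    apply: run_for => [|m s2 hmn [vU2 [k2 a2 h2]]].
      split; first by rewrite /= /upd eqxx.
      by split; [exact: k1 | exact: a1 | move=> t x [lt|[_ lt]] //; apply: h1].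
    have [x ex] := rk_surj hmn; subst m.
    rewrite /= /upd /= vU2 k2 bool_neq0 a2 hm ?(ltnW hi) // hr addn1.
    have [ik|ik] := ltnP i k; last first.
      split=> //=; split=> // t y [lt|[E _]]; first by apply: h2; left.
      by have := ltn_ord t; rewrite E ltnNge ik.
    have -> : i * n + rk x < L by have := rk_lt x; rewrite /L; nia.
    split=> //=; split=> //= t y hty; rewrite /= /upd addr_eq.
    case: (nat_of_ord t =P i) => [Et|ne] /=.
      case: (y =P x) => [->|yx]; first by rewrite inE -Et code_eqS.
      apply: h2; right; split=> //; case: hty => [|[_]];
        first by rewrite Et ltnn.
      rewrite ltnS leq_eqVlt => /orP[|//]; by rewrite rk_eq => /eqP.
    by apply: h2; case: hty => [lt|[E]]; [left | case: ne].
  split=> // t x lt; apply: h3; move: lt; rewrite ltnS leq_eqVlt.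
  by case/orP=> [/eqP|]; [right; rewrite rk_lt | left].
have -> : run n L p_out s =
  (let s1 := run n L p_write s in setv s1 vO (ar s1 MUL (va s1 vK))) by [].
case=> k1 a1 h1; cbv zeta; split.
  by rewrite /= /upd /= a1 k1 hm // k_le_n.
by move=> t x; apply: h1; apply: leq_trans (ltn_ord t) k_le_n.
Qed.

Hypothesis cds_d0 : forall b, cds (part d0 b).
Hypothesis sum_N : \sum_s N s = n.

Lemma gl_comP : let s' := run n L gl_com (Store (fun=> 0) (fun _ _ => 0) inp) in
  va s' vO = k * n /\ exists res : G -> option 'I_k,
  [/\ forall x, res x <> None,
      forall t, [/\ #|class res t| = N t, c t \in class res t
                  & induced_connected (class res t)]
    & forall (t : 'I_k) x, lo s' (t * n + rk x) = (x \in class res t)].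
Proof.
set s0 := Store _ _ _.
pose s1 := setv s0 vK (ev L (EM 1) s0).
have c1 : ctx 0 s1.
  by split=> //; rewrite /= /upd /= /flat /= inp1.
have -> : run n L gl_com s0 = run n L p_out (run n L p_main (run n L p_match
  (run n L p_term (run n L p_dom (run n L p_mul s1))))) by [].
have := run_mul c1 (fun=> erefl); set s2 := run n L p_mul s1 => -[c2 ag2 mul2].
have := run_dom c2 mul2; set s3 := run n L p_dom s2 => -[c3 ag3 dom3].
have mul3 u : u <= n -> ar s3 MUL u = u * n by move=> hu; rewrite ag3 // mul2.
have := run_term c3 mul3 dom3; set s4 := run n L p_term s3 => -[c4 ag4 term4].
have z4 t i : 4 < t -> ar s4 t i = 0.
  move=> lt; rewrite ag4; last by rewrite lt orbT.
  by rewrite ag3 ?ag2 //; lia.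
have hom4 (t : 'I_k) : ar s4 HOME t.+1 = home t by have [] := term4 t.
have := run_matching c4 hom4 (fun i => z4 SIG i isT) (fun i => z4 TAK i isT).
set s5 := run n L p_match s4 => -[c5 ag5 [grp [grp5 grp_home home_grp card_grp]]].
have st5 : static home grp d0 (ar s5).
  split=> //.
  - by move=> u hu; rewrite ag5 // ag4 // mul3.
  - by move=> x; rewrite ag5 // ag4 // dom3.
  - by move=> t; rewrite ag5 //; have [] := term4 t.
  - by move=> t; rewrite ag5.
  - by move=> t; rewrite ag5 //; have [] := term4 t.
have I5 : inv_main home grp (ar s5).
  exists d0, (fun=> None); split=> //.
    by move=> x; rewrite ag5 // z4.
  have z5 b : ar s5 SOL b = 0 by rewrite ag5 // z4.
  by split=> //= [x|t]; rewrite z5.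
have c5' : ctx_main s5 by have [] := c5.
have := run_main grp_home home_grp card_grp sum_N c5' I5.
set s6 := run n L p_main s5 => -[[k6 _] [d [res [st6 rs6 ps6]]] sol6].
have [oE loE] := run_out k6 (st_mul st6) rs6.
split=> //; exists res; split=> //.
  by move=> x; apply: (par_some ps6); apply: sol6.
move=> t; have [|h1 h2 h3] := par_class ps6 (s := t).
  by have [q hq] := home_grp (home t); rewrite -grp_home sol6.
by split=> //; rewrite inE h3.
Qed.

End Refinement.

(** * Encodings *)

Lemma nth_allpairs (S T : Type) (f : S -> T -> nat) x0 y0 s t i j :
  i < size s -> j < size t ->
  nth 0 [seq f x y | x <- s, y <- t] (i * size t + j) = f (nth x0 s i) (nth y0 t j).
Proof.
elim: s i => [//|x s IH] [|i] hi hj; rewrite /= nth_cat size_map.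
  by rewrite hj (nth_map y0).
by rewrite mulSn -addnA ltnNge leq_addr addKn; apply: IH.
Qed.

Lemma nth_encode_family (G : graph) (k : nat) (V : 'I_k -> {set G}) (s : 'I_k) x :
  nth 0 (encode_family V) (s * #|G| + rk x) = (x \in V s).
Proof.
rewrite [#|G|]cardE (nth_allpairs _ s x) ?size_enum_ord -?cardE ?ltn_ord //.
by rewrite nth_ord_enum nth_enum_rank.
Qed.

Lemma nth_encode_graph (G : graph) (x y : G) :
  nth 0 (encode_graph G) (rk x * #|G| + rk y) = adj x y.
Proof.
by rewrite [#|G|]cardE (nth_allpairs _ x x) -?cardE ?ltn_ord // !nth_enum_rank.
Qed.

Lemma size_encode_family (G : graph) (k : nat) (V : 'I_k -> {set G}) :
  size (encode_family V) = k * #|G|.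
Proof. by rewrite size_allpairs size_enum_ord -cardE. Qed.

Lemma size_encode_graph (G : graph) : size (encode_graph G) = #|G| * #|G|.
Proof. by rewrite size_allpairs -cardE. Qed.

Section Encoding.

Variables (I : gl_instance) (D : 'I_(gl_k I) -> {set gl_graph I}).

Let G := gl_graph I.
Let k := gl_k I.
Let n := #|G|.
Let w := encode_input D.

Lemma size_map_enum_ord (f : 'I_k -> nat) : size [seq f i | i <- enum 'I_k] = k.
Proof. by rewrite size_map size_enum_ord. Qed.

Lemma size_encode_input : size w = 2 + (n * n + (k + (k + k * n))).
Proof.
rewrite /w /encode_input !size_cat !size_map_enum_ord.
by rewrite size_encode_graph size_encode_family.
Qed.

Lemma nth_input_adj (x y : G) : nth 0 w (2 + (rk x * n + rk y)) = adj x y.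
Proof.
rewrite /w /encode_input /= nth_cat size_encode_graph.
have hx := rk_lt x; have hy := rk_lt y.
have -> : rk x * n + rk y < #|G| * #|G| by rewrite -/n; nia.
exact: nth_encode_graph.
Qed.

Lemma nth_input_term (s : 'I_k) :
  nth 0 w (2 + (n * n + s)) = rk (gl_term s).
Proof.
rewrite /w /encode_input /= nth_cat size_encode_graph add0n -/G -/n ltnNge leq_addr addKn /=.
rewrite nth_cat size_map_enum_ord ltn_ord (nth_map s) ?size_enum_ord //.
by rewrite nth_ord_enum.
Qed.

Lemma nth_input_size (s : 'I_k) :
  nth 0 w (2 + (n * n + (k + s))) = gl_size s.
Proof.
rewrite /w /encode_input /= nth_cat size_encode_graph add0n -/G -/n ltnNge leq_addr addKn /=.
rewrite nth_cat size_map_enum_ord ltnNge leq_addr addKn /=.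
rewrite nth_cat size_map_enum_ord ltn_ord (nth_map s) ?size_enum_ord //.
by rewrite nth_ord_enum.
Qed.

Lemma nth_input_dom (s : 'I_k) (x : G) :
  nth 0 w (2 + (n * n + (k + (k + (s * n + rk x))))) = (x \in D s).
Proof.
rewrite /w /encode_input /= nth_cat size_encode_graph add0n -/G -/n ltnNge leq_addr addKn /=.
do 2!rewrite nth_cat size_map_enum_ord ltnNge leq_addr addKn /=.
exact: nth_encode_family.
Qed.

Lemma run_gl_com : cds_partition D ->
  let s := run n (size w) gl_com (start w) in
  va s vO = k * n /\ exists V : 'I_k -> {set G},
    gl_partition V /\ mkseq (lo s) (k * n) = encode_family V.
Proof.
move=> [[disj cover] cdsD].
have ex x : exists i, x \in D i.
  have : x \in \bigcup_(i < k) D i by rewrite cover inE.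
  by move=> /bigcupP[i _ xi]; exists i.
(* The partition is turned into a function, the form in which vertices can be reassigned;
   disjointness makes the choice unique. *)
pose d x : 'I_k := xchoose (ex x).
have dE x i : (x \in D i) = (d x == i).
  have xd := xchooseP (ex x); apply/idP/eqP => [xi|<- //].
  apply/eqP; apply: contraT => ne; have := disj _ _ ne.
  by rewrite disjoint_subset => /subsetP/(_ x xd); rewrite inE /= xi.
have partE i : part d i = D i by apply/setP=> x; rewrite inE dE.
have dom (s : 'I_k) x : nth 0 w (2 + (n * n + (k + (k + (s * n + rk x))))) = (d x == s).
  by rewrite nth_input_dom dE.
have cdsd b : cds (part d b) by rewrite partE.
have [oE [res [tot cl out]]] := @gl_comP G k (@gl_term I) (@gl_size I)
  (@gl_term_inj I) (@gl_size_gt0 I) d (nth 0 w) erefl erefl nth_input_adj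
  nth_input_term nth_input_size dom cdsd (gl_size_sum I).
rewrite -size_encode_input in oE out *.
split=> //; exists (class res); split.
  split; last by move=> i; have [h1 h2 h3] := cl i.
  split.
    move=> i j ij; rewrite disjoint_subset; apply/subsetP=> x; rewrite !inE.
    by move=> /eqP->; rewrite (inj_eq Some_inj).
  apply/setP=> x; rewrite inE; apply/bigcupP.
  by case E: (res x) (tot x) => [i|//] _; exists i; rewrite // inE E.
apply: (@eq_from_nth _ 0); rewrite size_mkseq ?size_encode_family // => i hi.
rewrite nth_mkseq //.
have n0 : 0 < n by case: (n) hi => //; rewrite muln0.
(* Position i of the word is the entry in row i / n and column i mod n of the matrix. *)
have ik : i %/ n < k by rewrite ltn_divLR.
have [x ex_x] := rk_surj (ltn_pmod i n0 : i %% n < #|G|).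
have := out (Ordinal ik) x;
  have := nth_encode_family (class res) (Ordinal ik) x.
by rewrite -ex_x /= -divn_eq => -> ->.
Qed.

End Encoding.

Theorem theorem4 :
  exists (P : program) (c d : nat),
    forall (I : gl_instance) (D : 'I_(gl_k I) -> {set gl_graph I}),
      cds_partition D ->
      exists V : 'I_(gl_k I) -> {set gl_graph I},
        gl_partition V /\
        computes_within P (encode_input D) (encode_family V)
          (c * size (encode_input D) ^ d + c).
Proof.
have [P [c [d comp]]] := com_computable wf_gl_com (isT : vO < 16).
exists P, c, d => I D cdsD.
have [oE [V [glV outE]]] := run_gl_com cdsD.
exists V; split=> //; have := comp (encode_input D).
have -> : nth 0 (encode_input D) 0 = #|gl_graph I| by [].
(* Two side conditions remain: the loop bound n is below the length of the word, and the k n output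
   cells fit into it. *)
cbv zeta; rewrite oE outE; apply; rewrite size_encode_input; last lia.
by nia.
Qed.
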